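(* Let $\tau$ and $\sigma$ be permutations with $\tau\preceq\sigma$. If $\sigma$ is rigid then $\tau$ is rigid, and if $\sigma$ is pseudorigid then $\tau$ is pseudorigid. In other words, the class of pseudorigid permutations and the class of rigid permutations are closed under pattern containment.
   Context: $\tau\preceq\sigma$ means that $\sigma$ contains $\tau$ as a pattern: $\tau$ is order-isomorphic to a subsequence of $\sigma=\sigma_1\cdots\sigma_n$. Let $\Bbbk$ be an algebraically closed field of arbitrary characteristic. For $\sigma\in S_n$ let $Q$ be the quiver $1\to2\to\cdots\to N$ with $N=2n-1$, and $\Pi$ its preprojective algebra. For a segment $[a,b]$, $1\le a\le b\le N$, $M([a,b])$ is the representation of $Q$ with a one-dimensional space at each vertex of $[a,b]$, zero elsewhere, and nonzero maps along all arrows inside $[a,b]$. Let $\mathfrak m_\sigma=\sum_{i=1}^n[i,2n-\sigma_i]$ and $M(\mathfrak m_\sigma)=\bigoplus_{i}M([i,2n-\sigma_i])$, with underlying graded space $V=\bigoplus_v V_v$. Let $\Lambda(V)$ be the variety of pairs $(T,B)$, $T_v:V_v\to V_{v+1}$, $B_v:V_{v+1}\to V_v$, with $T_{v-1}B_{v-1}=B_vT_v$ on $V_v$ for all $1\le v\le N$ (maps involving $V_0=V_{N+1}=0$ being zero), i.e. of $\Pi$-module structures on $V$. Let $C_\sigma$ be the irreducible component of $\Lambda(V)$ which is the closure of the set of $(T,B)\in\Lambda(V)$ with $T\cong M(\mathfrak m_\sigma)$. The permutation $\sigma$ is rigid if there is $x\in C_\sigma$ with $\mathrm{Ext}^1_\Pi(x,x)=0$,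 and pseudorigid if there are $x,y\in C_\sigma$ with $\mathrm{Ext}^1_\Pi(x,y)=0$. *)

(* Defs.v *)
From mathcomp Require Import all_boot all_order all_algebra all_fingroup.
From mathcomp Require Import mpoly.

Set Implicit Arguments.
Unset Strict Implicit.
Unset Printing Implicit Defensive.

Import GRing.Theory.
Local Open Scope ring_scope.

(* Finite-dimensional spaces graded by the vertices 1, ..., N of A_N. The
   component at v is the space of row vectors of length [V v]; vertices are
   natural numbers, and the components outside 1, ..., N are zero. *)
Record grspace (N : nat) := GrSpace {
  gdim :> nat -> nat;
  gdim_out : forall v : nat, ~~ (0 < v <= N)%N -> gdim v = 0%N }.

(* Linear maps act on row vectors on the right: "A, then B" is [A *m B]. *)
Definition fwd_maps (k : fieldType) N (V : grspace N) :=
  forall v : nat, 'M[k]_(V v, V v.+1).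
Definition bwd_maps (k : fieldType) N (V : grspace N) :=
  forall v : nat, 'M[k]_(V v.+1, V v).
Definition graded_map (k : fieldType) N (V W : grspace N) :=
  forall v : nat, 'M[k]_(V v, W v).

Record qrep (k : fieldType) (N : nat) := QRep {
  qspace : grspace N;
  qmap : fwd_maps k qspace }.

Definition qrep_hom (k : fieldType) N (V W : grspace N)
    (T : fwd_maps k V) (T' : fwd_maps k W) (f : graded_map k V W) : Prop :=
  forall v, T v *m f v.+1 = f v *m T' v.

Definition qrep_iso (k : fieldType) N (V W : grspace N)
    (T : fwd_maps k V) (T' : fwd_maps k W) : Prop :=
  exists (f : graded_map k V W) (g : graded_map k W V),
    [/\ qrep_hom T T' f, qrep_hom T' T g &
        forall v, f v *m g v = 1%:M /\ g v *m f v = 1%:M].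

Definition zero_space (N : nat) : grspace N :=
  @GrSpace N (fun=> 0%N) (fun _ _ => erefl).

Definition zero_rep (k : fieldType) (N : nat) : qrep k N :=
  @QRep k N (zero_space N) (fun=> 0).

Lemma dsum_out N (V W : grspace N) v :
  ~~ (0 < v <= N)%N -> (V v + W v = 0)%N.
Proof. by move=> hv; rewrite !gdim_out. Qed.

Definition dsum_space N (V W : grspace N) : grspace N :=
  GrSpace (@dsum_out N V W).

Definition dsum_rep (k : fieldType) N (M M' : qrep k N) : qrep k N :=
  @QRep k N (dsum_space (qspace M) (qspace M'))
    (fun v => block_mx (qmap M v) 0 0 (qmap M' v)).

Definition is_segment (N a b : nat) : bool := [&& 0 < a, a <= b & b <= N]%N.

Lemma seg_out N a b v : is_segment N a b ->
  ~~ (0 < v <= N)%N -> nat_of_bool (a <= v <= b)%N = 0%N.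
Proof.
case/and3P=> a0 _ bN; apply: contraNeq; rewrite eqb0 negbK => /andP[av vb].
by rewrite (leq_trans a0 av) (leq_trans vb bN).
Qed.

Definition seg_space N a b (ab : is_segment N a b) : grspace N :=
  @GrSpace N (fun v => nat_of_bool (a <= v <= b)%N)
    (fun v => @seg_out N a b v ab).

(* The matrix at v is the 1 x 1 matrix 1 if v and v + 1 both lie in [a, b],
   and an empty matrix otherwise. *)
Definition seg_rep (k : fieldType) N a b (ab : is_segment N a b) : qrep k N :=
  @QRep k N (seg_space ab) (fun=> const_mx 1).

Definition datum (k : fieldType) N (V : grspace N) : Type :=
  (fwd_maps k V * bwd_maps k V)%type.

(* The relation at the vertex v + 1, for 1 <= v + 1 <= N. *)
Definition Lambda (k : fieldType) N (V : grspace N) (x : datum k V) : Prop :=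
  forall v, (v < N)%N -> x.2 v *m x.1 v = x.1 v.+1 *m x.2 v.+1.

Definition pi_hom (k : fieldType) N (V W : grspace N)
    (x : datum k V) (y : datum k W) (f : graded_map k V W) : Prop :=
  forall v, x.1 v *m f v.+1 = f v *m y.1 v /\ x.2 v *m f v = f v.+1 *m y.2 v.

(* 0 -> y -> z -> x -> 0 *)
Definition short_exact (k : fieldType) N (W E V : grspace N)
    (y : datum k W) (z : datum k E) (x : datum k V)
    (f : graded_map k W E) (g : graded_map k E V) : Prop :=
  [/\ pi_hom y z f, pi_hom z x g &
      forall v, [/\ row_free (f v), row_full (g v)
                  & (f v == kermx (g v))%MS]].

(* Ext^1(x, y) = 0 for Yoneda's Ext^1, whose elements are the classes of the
   extensions of x by y and whose zero is the class of the split ones. *)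
Definition Ext1_zero (k : fieldType) N (V W : grspace N)
    (x : datum k V) (y : datum k W) : Prop :=
  forall (E : grspace N) (z : datum k E)
         (f : graded_map k W E) (g : graded_map k E V),
    Lambda z -> short_exact y z x f g ->
    exists2 h : graded_map k V E, pi_hom x z h & forall v, h v *m g v = 1%:M.

Inductive coord N (V : grspace N) : Type :=
  | TCoord (v : nat) of 'I_(V v) & 'I_(V v.+1)
  | BCoord (v : nat) of 'I_(V v.+1) & 'I_(V v).

Definition coord_val (k : fieldType) N (V : grspace N) (x : datum k V)
    (c : coord V) : k :=
  match c with
  | TCoord v i j => x.1 v i j
  | BCoord v i j => x.2 v i j
  end.

(* Closure in the affine space of all pairs (T, B), in which Lambda(V) is
   closed. A polynomial function is a polynomial P in m variables evaluated at m
   coordinates c. *)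
Definition zariski_closure (k : fieldType) N (V : grspace N)
    (S : datum k V -> Prop) (x : datum k V) : Prop :=
  forall (m : nat) (P : {mpoly k[m]}) (c : 'I_m -> coord V),
    (forall y, S y -> P.@[fun i => coord_val y (c i)] = 0) ->
    P.@[fun i => coord_val x (c i)] = 0.

(* 'S_n permutes 0, ..., n - 1, so that the i-th segment
    [i, 2n - sigma_i] is [i.+1, 2n - (sigma i).+1]. *)

Lemma perm_segment n (sigma : 'S_n) (i : 'I_n) :
  is_segment (2 * n - 1) i.+1 (2 * n - (sigma i).+1).
Proof.
rewrite /is_segment /= leq_sub2l // andbT leq_subRL; last first.
  by rewrite mul2n -addnn (leq_trans (ltn_ord _)) ?leq_addr.
by rewrite mul2n -addnn leq_add.
Qed.

Definition M_perm (k : fieldType) n (sigma : 'S_n) : qrep k (2 * n - 1) :=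
  \big[@dsum_rep k (2 * n - 1) / zero_rep k (2 * n - 1)]_(i < n)
    seg_rep k (perm_segment sigma i).

Definition V_perm (k : fieldType) n (sigma : 'S_n) : grspace (2 * n - 1) :=
  qspace (M_perm k sigma).

Definition C_perm (k : fieldType) n (sigma : 'S_n)
    (x : datum k (V_perm k sigma)) : Prop :=
  Lambda x /\
  zariski_closure
    (fun y : datum k (V_perm k sigma) =>
       Lambda y /\ qrep_iso y.1 (qmap (M_perm k sigma))) x.

Definition rigid (k : fieldType) n (sigma : 'S_n) : Prop :=
  exists x : datum k (V_perm k sigma), C_perm x /\ Ext1_zero x x.

Definition pseudorigid (k : fieldType) n (sigma : 'S_n) : Prop :=
  exists x y : datum k (V_perm k sigma),
    [/\ C_perm x, C_perm y & Ext1_zero x y].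

Definition pattern_in m n (tau : 'S_m) (sigma : 'S_n) : Prop :=
  exists f : 'I_m -> 'I_n,
    (forall i j : 'I_m, (i < j)%N -> (f i < f j)%N) /\
    (forall i j : 'I_m, (tau i < tau j)%N = (sigma (f i) < sigma (f j))%N).

(* Main.v *)
From HB Require Import structures.
Require Import Defs.
From mathcomp Require Import all_boot all_order all_algebra all_fingroup.
From mathcomp Require Import mpoly zify ring.
From Stdlib Require Import Classical_Prop.

Set Implicit Arguments.
Unset Strict Implicit.
Unset Printing Implicit Defensive.

Import GRing.Theory.
Local Open Scope ring_scope.

(** All the segments of [sigma] contain the vertex [n]. Hence a point of the
    component whose arrows [T] define the representation of [sigma] is described
    by one square matrix [X] ([lowering_mapP]), with [X a b] nonzero only if
    [b < a] and [sigma a < sigma b]. For this strict order on the positions, [X] lies in the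
    radical J of the incidence algebra A of a finite poset. Given two such points,
    with matrices [X] and [Y], the extension group vanishes if and only if both
    commutator maps A -> J, [H |-> X H - H Y] and [H |-> Y H - H X], are onto
    ([ext_exact_onto], [ext_exact_sym], [onto_ext_exact]): the extensions are the
    middle cohomology of a three-term complex, and the complexes of [(x, y)] and
    of [(y, x)] are dual under the trace pairing. As vanishing of this cohomology
    is an open condition ([ext_exact_open]), a pair of points of the closure with
    vanishing extension group may be replaced by points of the above form
    ([ext_exact_general]). So [sigma] is pseudorigid if and only if there are [X]
    and [Y] in J for which both commutator maps are onto, and rigid if and only if
    one can take [X = Y].

    A pattern of [sigma] corresponds to a subposet, and points may be removed one
    at a time ([onto_pair_delete]). Restricting [X] to the smaller poset does not
    preserve surjectivity. Instead, to remove a point [p], move [X] and [Y] to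
    [X + c E_p] and [Y + c E_p], where [E_p] is the diagonal matrix unit at [p].
    The two diagonal terms cancel in the commutators, which therefore stay in J,
    and for all but finitely many scalars [c] the commutator maps stay onto
    ([commutator_onto_generic]). But if [c] is not zero, then [X + c E_p] is
    conjugate under A to the direct sum of the scalar [c] and of a radical element
    of the incidence algebra of the smaller poset ([delete_pointP]), and
    compressing the commutator map to the latter keeps it onto. *)

(** * Exactness is an open condition *)

Section Openness.

Variables (k : fieldType) (Omega : Type) (P : (Omega -> k) -> Prop).

(** The regular functions on a parameter space, kept abstract because openness
    is needed both on a space of module structures and on a line. *)
Record function_ring : Prop := FunctionRing {
  fring_ext : forall F G, F =1 G -> P F -> P G;
  fring_const : forall c : k, P (fun=> c);
  fring_add : forall F G, P F -> P G -> P (fun w => F w + G w);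
  fring_mul : forall F G, P F -> P G -> P (fun w => F w * G w) }.

Hypothesis Pring : function_ring.

Definition regular_mx m n (F : Omega -> 'M[k]_(m, n)) : Prop :=
  forall i j, P (fun w => F w i j).

Lemma fring_sum (I : Type) (r : seq I) (F : I -> Omega -> k) :
  (forall i, P (F i)) -> P (fun w => \sum_(i <- r) F i w).
Proof.
move=> HF; elim: r => [|i r IHr].
  by apply: fring_ext (fring_const Pring 0) => // w; rewrite big_nil.
by apply: fring_ext (fring_add Pring (HF i) IHr) => // w; rewrite big_cons.
Qed.

Lemma fring_prod (I : Type) (r : seq I) (F : I -> Omega -> k) :
  (forall i, P (F i)) -> P (fun w => \prod_(i <- r) F i w).
Proof.
move=> HF; elim: r => [|i r IHr].
  by apply: fring_ext (fring_const Pring 1) => // w; rewrite big_nil.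
by apply: fring_ext (fring_mul Pring (HF i) IHr) => // w; rewrite big_cons.
Qed.

Lemma regular_mx_ext m n (F G : Omega -> 'M[k]_(m, n)) :
  F =1 G -> regular_mx F -> regular_mx G.
Proof.
by move=> FG HF i j; apply: fring_ext (HF i j) => // w; rewrite FG.
Qed.

Lemma regular_const m n (A : 'M[k]_(m, n)) : regular_mx (fun=> A).
Proof. by move=> i j; apply: fring_const. Qed.

Lemma regular_add m n (F G : Omega -> 'M[k]_(m, n)) :
  regular_mx F -> regular_mx G -> regular_mx (fun w => F w + G w).
Proof.
move=> HF HG i j; apply: fring_ext (fring_add Pring (HF i j) (HG i j)) => // w.
by rewrite mxE.
Qed.

Lemma regular_mul m n p (F : Omega -> 'M[k]_(m, n)) (G : Omega -> 'M[k]_(n, p)) :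
  regular_mx F -> regular_mx G -> regular_mx (fun w => F w *m G w).
Proof.
move=> HF HG i j.
have HFG l : P (fun w => F w i l * G w l j) by apply: fring_mul.
by apply: fring_ext (fring_sum (index_enum 'I_n) HFG) => // w; rewrite mxE.
Qed.

Lemma regular_opp m n (F : Omega -> 'M[k]_(m, n)) :
  regular_mx F -> regular_mx (fun w => - F w).
Proof.
move=> HF; apply: regular_mx_ext (regular_mul (regular_const (- 1%:M)) HF) => w.
by rewrite mulNmx mul1mx.
Qed.

Lemma regular_sub m n (F G : Omega -> 'M[k]_(m, n)) :
  regular_mx F -> regular_mx G -> regular_mx (fun w => F w - G w).
Proof. by move=> HF /regular_opp; apply: regular_add. Qed.

Lemma regular_sum m n (I : Type) (r : seq I) (F : I -> Omega -> 'M[k]_(m, n)) :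
  (forall i, regular_mx (F i)) -> regular_mx (fun w => \sum_(i <- r) F i w).
Proof.
move=> HF i j.
have HFij l : P (fun w => F l w i j) by apply: HF.
by apply: fring_ext (fring_sum r HFij) => // w; rewrite summxE.
Qed.

Lemma regular_row_mx m n1 n2 (F : Omega -> 'M[k]_(m, n1))
    (G : Omega -> 'M[k]_(m, n2)) :
  regular_mx F -> regular_mx G -> regular_mx (fun w => row_mx (F w) (G w)).
Proof.
move=> HF HG i j; case: (split_ordP j) => l ->.
  by apply: fring_ext (HF i l) => // w; rewrite row_mxEl.
by apply: fring_ext (HG i l) => // w; rewrite row_mxEr.
Qed.

Lemma regular_det n (F : Omega -> 'M[k]_n) :
  regular_mx F -> P (fun w => \det (F w)).
Proof.
move=> HF; apply: fring_sum => s; apply: fring_mul => //.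
  exact: fring_const.
exact: fring_prod.
Qed.

(** If the middle cohomology of a complex vanishes at one parameter, a
    contracting homotopy [(s, t)] is available there; the determinant of
    [d1 t + s d0] for these fixed [s], [t] is the required function. *)
Lemma open_exact_mx p q r (d0 : Omega -> 'M[k]_(p, q))
    (d1 : Omega -> 'M[k]_(q, r)) (w0 : Omega) :
  regular_mx d0 -> regular_mx d1 -> (kermx (d1 w0) <= d0 w0)%MS ->
  exists F, [/\ P F, F w0 != 0 & forall w, F w != 0 -> d0 w *m d1 w = 0 ->
    (kermx (d1 w) <= d0 w)%MS].
Proof.
move=> Hd0 Hd1 ex0; pose t := pinvmx (d1 w0).
have /submxP[s Hs] : (1%:M - d1 w0 *m t <= d0 w0)%MS.
  apply: submx_trans ex0; rewrite sub_kermx mulmxBl mul1mx.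
  by rewrite mulmxKpV ?subrr // submx_refl.
clearbody t; exists (fun w => \det (d1 w *m t + s *m d0 w)); split.
- apply/regular_det/regular_add; apply: regular_mul => //; exact: regular_const.
- by rewrite -Hs addrC subrK det1 oner_eq0.
move=> w; rewrite -unitfE -/(_ \in unitmx) => Hu d01.
have sub01 : (d0 w <= kermx (d1 w))%MS by rewrite sub_kermx d01.
rewrite -(mxrank_leqif_sup sub01).2.
rewrite eqn_leq mxrankS //=.
rewrite -(mxrankMfree (kermx (d1 w)) (B := d1 w *m t + s *m d0 w)); last first.
  by rewrite row_free_unit.
by rewrite mulmxDr !mulmxA mulmx_ker mul0mx add0r mxrankS // submxMl.
Qed.

Lemma lin_mxE m n m' n' (f : 'M[k]_(m, n) -> 'M[k]_(m', n')) A :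
  linear f -> mxvec A *m lin_mx f = mxvec (f A).
Proof.
move=> f_lin;
  pose fL : {linear _ -> _} := HB.pack f (GRing.isLinear.Build _ _ _ _ f f_lin).
exact: (mul_vec_lin fL).
Qed.

Lemma regular_lin_mx m n m' n' (f : Omega -> 'M[k]_(m, n) -> 'M[k]_(m', n')) :
  (forall A, regular_mx (fun w => f w A)) -> regular_mx (fun w => lin_mx (f w)).
Proof.
move=> Hf i j; case: (mxvec_indexP j) => a b.
apply: fring_ext (Hf (vec_mx (delta_mx 0 i)) a b) => // w.
by rewrite [RHS]mxE /= mxvecE.
Qed.

Lemma open_exact m0 n0 m1 n1 m2 n2
    (f0 : Omega -> 'M[k]_(m0, n0) -> 'M[k]_(m1, n1))
    (f1 : Omega -> 'M[k]_(m1, n1) -> 'M[k]_(m2, n2)) (w0 : Omega) :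
  (forall w, linear (f0 w)) -> (forall w, linear (f1 w)) ->
  (forall A, regular_mx (fun w => f0 w A)) ->
  (forall A, regular_mx (fun w => f1 w A)) ->
  (forall A, f1 w0 A = 0 -> exists B, A = f0 w0 B) ->
  exists F, [/\ P F, F w0 != 0 & forall w, F w != 0 ->
    (forall B, f1 w (f0 w B) = 0) ->
    forall A, f1 w A = 0 -> exists B, A = f0 w B].
Proof.
move=> lin0 lin1 reg0 reg1 ex0.
have [|F [PF F0 HF]] := open_exact_mx (w0 := w0)
    (regular_lin_mx reg0) (regular_lin_mx reg1).
  apply/rV_subP => u /sub_kermxP; rewrite -[u]vec_mxK lin_mxE // => u0.
  have [|B ->] := ex0 (vec_mx u); first by rewrite -[LHS]mxvecK u0 raddf0.
  by rewrite -lin_mxE // submxMl.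
exists F; split=> // w Fw0 cplx A A0.
have /submxP[v Hv] : (mxvec A <= lin_mx (f0 w))%MS.
  apply: submx_trans (HF w Fw0 _).
    by rewrite sub_kermx lin_mxE // A0 linear0.
  apply/row_matrixP => i; rewrite row0 rowE mulmxA -[delta_mx _ _]vec_mxK.
  by rewrite !lin_mxE // cplx linear0.
exists (vec_mx v); apply: (can_inj mxvecK).
by rewrite Hv -{1}[v]vec_mxK lin_mxE.
Qed.

End Openness.

(** * Deleting a point of a poset *)

Section Support.

Variables (k : fieldType) (m n p : nat).

Definition supported (r : 'I_m -> 'I_n -> bool) (M : 'M[k]_(m, n)) : Prop :=
  forall a b, ~~ r a b -> M a b = 0.

Definition mask (r : 'I_m -> 'I_n -> bool) (M : 'M[k]_(m, n)) : 'M[k]_(m, n) :=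
  \matrix_(a, b) if r a b then M a b else 0.

Lemma supported_mask r M : supported r (mask r M).
Proof. by move=> a b /negbTE rab; rewrite mxE rab. Qed.

Lemma maskE r M : supported r M -> mask r M = M.
Proof.
by move=> rM; apply/matrixP=> a b; rewrite mxE; case: ifPn => // /rM ->.
Qed.

Lemma mask_linear r : linear (mask r).
Proof.
move=> c A B; apply/matrixP=> a b; rewrite !mxE.
by case: ifP; rewrite ?mulr0 ?addr0.
Qed.

Lemma supportedW (r s : 'I_m -> 'I_n -> bool) M :
  (forall a b, r a b -> s a b) -> supported r M -> supported s M.
Proof. by move=> rs rM a b /(contra (rs a b))/rM. Qed.

Lemma supportedD r A B : supported r A -> supported r B -> supported r (A + B).
Proof. by move=> rA rB a b nr; rewrite mxE rA ?rB ?addr0. Qed.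

Lemma supportedN r A : supported r A -> supported r (- A).
Proof. by move=> rA a b nr; rewrite mxE rA ?oppr0. Qed.

Lemma supportedB r A B : supported r A -> supported r B -> supported r (A - B).
Proof. by move=> rA rB; apply/supportedD/supportedN. Qed.

Lemma supportedZ r c A : supported r A -> supported r (c *: A).
Proof. by move=> rA a b nr; rewrite mxE rA ?mulr0. Qed.

End Support.

Lemma mulmx_disjoint (k : fieldType) m n p (r : 'I_m -> 'I_n -> bool)
    (s : 'I_n -> 'I_p -> bool) (A : 'M[k]_(m, n)) (B : 'M[k]_(n, p)) :
  supported r A -> supported s B ->
  (forall a c b, r a c -> s c b -> false) -> A *m B = 0.
Proof.
move=> rA sB rs; apply/matrixP=> a b; rewrite !mxE big1 // => c _.
case rac: (r a c); last by rewrite rA ?rac ?mul0r.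
case scb: (s c b); last by rewrite sB ?scb ?mulr0.
by have := rs a c b rac scb.
Qed.

Lemma supportedM (k : fieldType) m n p (r : 'I_m -> 'I_n -> bool)
    (s : 'I_n -> 'I_p -> bool) (t : 'I_m -> 'I_p -> bool)
    (A : 'M[k]_(m, n)) (B : 'M[k]_(n, p)) :
  (forall a c b, r a c -> s c b -> t a b) ->
  supported r A -> supported s B -> supported t (A *m B).
Proof.
move=> rst rA sB a b ntab; rewrite mxE big1 // => c _.
case rac: (r a c); last by rewrite rA ?rac ?mul0r.
case scb: (s c b); last by rewrite sB ?scb ?mulr0.
by rewrite (rst a c b) in ntab.
Qed.

Section Polynomials.

Variable k : fieldType.

Definition polynomial_fun (F : k -> k) : Prop :=
  exists P : {poly k}, forall c, F c = P.[c].

Lemma polynomial_fun_ring : function_ring polynomial_fun.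
Proof.
split.
- by move=> F G FG [P HP]; exists P => c; rewrite -FG.
- by move=> c; exists c%:P => w; rewrite hornerC.
- by move=> F G [P HP] [Q HQ]; exists (P + Q) => c; rewrite hornerD HP HQ.
- by move=> F G [P HP] [Q HQ]; exists (P * Q) => c; rewrite hornerM HP HQ.
Qed.

End Polynomials.

Section Poset.

Variables (k : closedFieldType) (n : nat) (lt : rel 'I_n).
Hypothesis lt_trans : transitive lt.
Hypothesis lt_dec : forall a b, lt a b -> (b < a)%N.
Implicit Types (I : {set 'I_n}) (X Y Z H N : 'M[k]_n).

Definition le_on I (a b : 'I_n) := [&& a \in I, b \in I & (a == b) || lt a b].
Definition lt_on I (a b : 'I_n) := [&& a \in I, b \in I & lt a b].

(** The matrices supported on [le_on I] form the incidence algebra of the poset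
    [I], and those supported on [lt_on I] its radical. *)
Definition commutator_onto I X Y : Prop :=
  forall Z, supported (lt_on I) Z ->
  exists2 H, supported (le_on I) H & Z = X *m H - H *m Y.

Lemma lt_irr a : lt a a = false.
Proof. by apply/negP=> /lt_dec; rewrite ltnn. Qed.

Lemma le_lt_trans a b c : (a == b) || lt a b -> lt b c -> lt a c.
Proof. by case/predU1P=> [->//|]; apply: lt_trans. Qed.

Lemma lt_le_trans a b c : lt a b -> (b == c) || lt b c -> lt a c.
Proof. by move=> ab /predU1P[<-//|]; apply: lt_trans. Qed.

Lemma le_trans a b c : (a == b) || lt a b -> (b == c) || lt b c ->
  (a == c) || lt a c.
Proof. by move=> /predU1P[->//|ab] /(lt_le_trans ab) ->; rewrite orbT. Qed.

Lemma delta_mulE (p : 'I_n) H a b :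
  (delta_mx p p *m H) a b = if a == p then H p b else 0.
Proof.
rewrite mxE (bigD1 p) //= big1 => [|j /negPf jp]; rewrite !mxE ?eqxx ?andbT.
  by case: eqP => _; rewrite ?mul1r ?mul0r addr0.
by rewrite jp andbF mul0r.
Qed.

Lemma mul_deltaE (p : 'I_n) H a b :
  (H *m delta_mx p p) a b = if b == p then H a p else 0.
Proof.
rewrite mxE (bigD1 p) //= big1 => [|j /negPf jp]; rewrite !mxE ?eqxx //=.
  by case: eqP => _; rewrite ?mulr1 ?mulr0 addr0.
by rewrite jp mulr0.
Qed.

(** The commutators of the perturbed matrices stay in the radical because their
    [(p, p)] entries cancel, so that openness applies on the line of all [c]. *)
Lemma commutator_onto_generic (p : 'I_n) I X Y : p \in I ->
  supported (lt_on I) X -> supported (lt_on I) Y -> commutator_onto I X Y ->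
  exists2 P : {poly k}, P.[0] != 0 & forall c : k, P.[c] != 0 ->
    commutator_onto I (X + c *: delta_mx p p) (Y + c *: delta_mx p p).
Proof.
move=> pI supX supY ontoXY; set E := delta_mx p p.
pose f0 c H := (X + c *: E) *m mask (le_on I) H - mask (le_on I) H *m (Y + c *: E).
pose f1 (c : k) Z := Z - mask (lt_on I) Z.
have f1E c Z : f1 c Z = 0 <-> supported (lt_on I) Z.
  split=> [/eqP|/maskE]; rewrite /f1; last by move->; rewrite subrr.
  by rewrite subr_eq0 => /eqP ->; apply: supported_mask.
have regE : regular_mx (@polynomial_fun k) (fun c : k => c *: E).
  move=> i j; exists (E i j *: 'X) => c.
  by rewrite mxE hornerZ hornerX mulrC.
have PR := polynomial_fun_ring k.
have [|||||F [[P HP] F0 HF]] := @open_exact k k _ PR _ _ _ _ _ _ f0 f1 0.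
- move=> c a A B; rewrite /f0 mask_linear; move: (X + _) (Y + _) => X' Y'.
  by rewrite mulmxDr mulmxDl -scalemxAr -scalemxAl scalerBr opprD addrACA.
- by move=> c a A B; rewrite /f1 mask_linear scalerBr opprD addrACA.
- move=> H; apply: regular_sub => //; apply: regular_mul => //;
    try exact: regular_const; apply: regular_add => //; exact: regular_const.
- by move=> Z; apply: regular_const.
- move=> Z /f1E supZ; have [H supH ->] := ontoXY Z supZ.
  by exists H; rewrite /f0 scale0r !addr0 maskE.
exists P => [|c Pc]; first by rewrite -HP.
move=> Z supZ; have [|||H HZ] := HF c _ _ Z; first by rewrite HP.
- move=> H; apply/f1E; rewrite /f0 mulmxDl mulmxDr opprD addrACA.
  have := @supported_mask _ _ _ (le_on I) H; move: (mask _ _) => M supH.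
  apply: supportedD; first apply: supportedB.
  + apply: supportedM supX supH => a d b /and3P[aI dI ad] /and3P[_ bI db].
    by rewrite /lt_on aI bI (lt_le_trans ad db).
  + apply: supportedM supH supY => a d b /and3P[aI dI ad] /and3P[_ bI db].
    by rewrite /lt_on aI bI (le_lt_trans ad db).
  rewrite -scalemxAl -scalemxAr -scalerBr; apply: supportedZ => a b nab.
  rewrite mxE [X in _ + X]mxE delta_mulE mul_deltaE.
  have [?|ap] := eqVneq a p; have [?|bp] := eqVneq b p; subst.
  + by rewrite subrr.
  + rewrite subr0 supH //; apply: contra nab => /and3P[_ bI].
    by rewrite eq_sym (negPf bp) /lt_on pI bI.
  + rewrite sub0r supH ?oppr0 //; apply: contra nab => /and3P[aI _].
    by rewrite (negPf ap) /lt_on aI pI.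
  + by rewrite subrr.
- by apply/f1E.
by exists (mask (le_on I) H) => //; apply: supported_mask.
Qed.

Lemma nilpotent_pow N j : supported lt N ->
  supported (fun a b => (b + j <= a)%N) (N ^+ j).
Proof.
move=> supN; elim: j => [|j IHj].
  move=> a b; rewrite addn0 -ltnNge expr0 !mxE => ab.
  by case: eqVneq ab => // ->; rewrite ltnn.
rewrite exprS; apply: supportedM supN IHj => a c b /lt_dec ca bc.
by rewrite addnS; apply: leq_ltn_trans bc ca.
Qed.

Definition resolvent (c : k) N : 'M[k]_n := \sum_(i < n) c ^- i.+1 *: N ^+ i.

(** The resolvent of a nilpotent matrix is a geometric series, which is why it
    stays inside the incidence algebra. *)
Lemma resolventP I N (c : k) : c != 0 -> supported (lt_on I) N ->
  [/\ resolvent c N *m (c%:M - N) = 1%:M, (c%:M - N) *m resolvent c N = 1%:M &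
    supported (fun a b => (a == b) || lt_on I a b) (resolvent c N)].
Proof.
move=> c0 supN.
have Nn : N ^+ n = 0.
  apply/matrixP=> a b; rewrite [RHS]mxE; apply: (@nilpotent_pow N n).
    by apply: supportedW supN => a' b' /and3P[].
  by rewrite -ltnNge (leq_trans (ltn_ord a)) ?leq_addl.
have tel (M : 'M[k]_n) :
    M = \sum_(i < n) (c ^- i *: N ^+ i - c ^- i.+1 *: N ^+ i.+1) -> M = 1%:M.
  have tel' j : \sum_(i < j) (c ^- i *: N ^+ i - c ^- i.+1 *: N ^+ i.+1) =
      1%:M - c ^- j *: N ^+ j.
    elim: j => [|j IHj]; last by rewrite big_ord_recr IHj /= addrA subrK.
    by rewrite big_ord0 !expr0 invr1 scale1r subrr.
  by rewrite tel' Nn scaler0 subr0.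
split.
- apply: tel; rewrite mulmx_suml; apply: eq_bigr => i _.
  have NS : N ^+ i *m N = N ^+ i.+1 by rewrite exprSr.
  rewrite mulmxBr mul_mx_scalar -scalemxAl NS.
  by rewrite scalerA exprS invfM mulrA mulfV // mul1r.
- apply: tel; rewrite mulmx_sumr; apply: eq_bigr => i _.
  have NS : N *m N ^+ i = N ^+ i.+1 by rewrite exprS.
  rewrite mulmxBl mul_scalar_mx -scalemxAr NS.
  by rewrite scalerA exprS invfM mulrA mulfV // mul1r.
move=> a b; rewrite negb_or => /andP[ab nab]; rewrite summxE big1 // => i _.
rewrite mxE; case: (nat_of_ord i) => [|j];
  first by rewrite expr0 !mxE (negPf ab) mulr0.
suff -> : (N ^+ j.+1) a b = 0 by rewrite mulr0.
elim: j a b {ab} nab => [|j IHj] a b; first by rewrite expr1; apply: supN.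
rewrite exprS;
  apply: supportedM supN IHj a b => a d b /and3P[aI dI ad] /and3P[_ bI db].
by rewrite /lt_on aI bI (lt_trans ad db).
Qed.

(** [X + c E_p] is conjugate, by a unit of the incidence algebra, to the direct
    sum of the scalar [c] at [p] and of this matrix, a Schur complement. *)
Definition delete_point I (p : 'I_n) (c : k) X : 'M[k]_n :=
  let N := mask (lt_on I) X in
  N - mask (fun a b => (a \in I) && (b == p)) X *m
      (mask (fun a b => (a == p) && (b \in I)) X *m resolvent c N).

(* Closes a goal [A *m B = 0] in which the columns of [A] and the rows of [B]
   lie one in [I] and the other at a point outside [I]. *)
Ltac disjoint I nIp A B :=
  let d := fresh in let dI := fresh in
  apply: (mulmx_disjoint A B) => ? d ? /=; rewrite ?/lt_on;
  case dI: (d \in I); rewrite ?(nIp _ dI) ?andbF ?andbT //=.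

(** [G] embeds the complement of the eigenvector of [X + c E_p] for the
    eigenvalue [c], and [P] is the projection along this eigenvector. *)
Lemma delete_pointP I (p : 'I_n) (c : k) X : p \notin I -> c != 0 ->
  supported (lt_on (p |: I)) X ->
  let X' := delete_point I p c X in let Xc := X + c *: delta_mx p p in
  exists G P,
    [/\ supported (fun a b => le_on (p |: I) a b && (b \in I)) G,
        supported (fun a b => le_on (p |: I) a b && (a \in I)) P,
        P *m G = mask (fun a b => (a == b) && (a \in I)) 1%:M,
        Xc *m G = G *m X' & P *m Xc = X' *m P] /\ supported (lt_on I) X'.
Proof.
move=> pI c0 supX X' Xc; rewrite {}/X' /delete_point.
set N := mask (lt_on I) X; set al := mask _ X; set be := mask _ X.
have supN : supported (lt_on I) N by apply: supported_mask.
have [QL QR] := resolventP c0 supN; set Q := resolvent c N => supQ.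
pose E : 'M[k]_n := delta_mx p p.
pose e : 'M[k]_n := mask (fun a b => (a == b) && (a \in I)) 1%:M.
have nIp a : a \in I -> (a == p) = false by apply: contraTF => /eqP ->.
have supe : supported (fun a b => [&& a \in I, b \in I & a == b]) e.
  by move=> a b; rewrite !mxE; case: eqVneq => [->|]; case: (b \in I).
have supE : supported (fun a b => (a == p) && (b == p)) E.
  by move=> a b /negPf; rewrite mxE => ->.
have supal : supported (fun a b => [&& a \in I, b == p & lt a p]) al.
  move=> a b; rewrite mxE; case: ifP => //= /andP[aI /eqP ->];
    rewrite aI eqxx /= => nap.
  by apply: supX; rewrite /lt_on (negPf nap) !andbF.
have supbe : supported (fun a b => [&& a == p, b \in I & lt p b]) be.
  move=> a b; rewrite mxE; case: ifP => //= /andP[/eqP -> bI];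
    rewrite bI eqxx /= => nap.
  by apply: supX; rewrite /lt_on (negPf nap) !andbF.
have XE : X = N + al + be.
  apply/matrixP=> a b; rewrite !mxE /lt_on.
  have [aI|aI] := boolP (a \in I); have [bI|bI] := boolP (b \in I) => /=.
  - rewrite !nIp //= !addr0; case: ifPn => // nab; apply: supX.
    by rewrite /lt_on (negPf nab) !andbF.
  - rewrite andbF addr0 add0r; case: ifPn => // bp; apply: supX.
    by rewrite /lt_on !inE (negPf bp) (negPf bI) /= andbF.
  - rewrite add0r andbT add0r; case: ifPn => // ap; apply: supX.
    by rewrite /lt_on !inE (negPf ap) (negPf aI).
  - rewrite andbF !addr0; apply: supX; apply/negP => /and3P[].
    by rewrite !inE (negPf aI) (negPf bI) !orbF => /eqP -> /eqP ->; rewrite lt_irr.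
set l := be *m Q; pose r := Q *m al.
have supr : supported (fun a b => [&& a \in I, b == p & lt a p]) r.
  apply: supportedM supQ supal => a d b /predU1P[->|/and3P[aI _ ad]] // /and3P[_ bp db].
  by rewrite aI bp (lt_trans ad db).
have supl : supported (fun a b => [&& a == p, b \in I & lt p b]) l.
  apply: supportedM supbe supQ => a d b /and3P[ap dI pd] /predU1P[<-|/and3P[_ bI db]].
    by rewrite ap dI.
  by rewrite ap bI (lt_trans pd db).
have lE : l *m (c%:M - N) = be by rewrite -mulmxA QL mulmx1.
have rE : (c%:M - N) *m r = al by rewrite mulmxA QR mul1mx.
have idl A : supported (fun a _ => a \in I) A -> e *m A = A.
  move=> supA; apply/matrixP=> a b; rewrite mxE (bigD1 a) //= big1 => [|j ja].
    rewrite !mxE eqxx addr0 /=; case: ifPn => aI; rewrite ?mul1r ?mul0r //.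
    by rewrite supA.
  by rewrite !mxE eq_sym (negPf ja) mul0r.
have idr A : supported (fun _ b => b \in I) A -> A *m e = A.
  move=> supA; apply/matrixP=> a b; rewrite mxE (bigD1 b) //= big1 => [|j jb].
    rewrite !mxE eqxx addr0 /=; case: ifPn => bI; rewrite ?mulr1 ?mulr0 //.
    by rewrite supA.
  by rewrite !mxE (negPf jb) mulr0.
have ee : e *m e = e by apply: idl; apply: supportedW supe => a b /and3P[].
have eN : e *m N = N by apply: idl; apply: supportedW supN => a b /and3P[].
have eal : e *m al = al by apply: idl; apply: supportedW supal => a b /and3P[].
have ebe : e *m be = 0 by disjoint I nIp supe supbe.
have eE : e *m E = 0 by disjoint I nIp supe supE.
have el : e *m l = 0 by disjoint I nIp supe supl.
have er : e *m r = r by apply: idl; apply: supportedW supr => a b /and3P[].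
have Ne : N *m e = N by apply: idr; apply: supportedW supN => a b /and3P[].
have ale : al *m e = 0 by disjoint I nIp supal supe.
have bee : be *m e = be by apply: idr; apply: supportedW supbe => a b /and3P[].
have Ee : E *m e = 0 by disjoint I nIp supE supe.
have le : l *m e = l by apply: idr; apply: supportedW supl => a b /and3P[].
have re : r *m e = 0 by disjoint I nIp supr supe.
have Nl : N *m l = 0 by disjoint I nIp supN supl.
have bel : be *m l = 0 by disjoint I nIp supbe supl.
have El : E *m l = l.
  apply/matrixP=> a b; rewrite delta_mulE; case: eqP => [->//|/eqP/negPf ap].
  by rewrite supl // ap.
have ll : l *m l = 0 by disjoint I nIp supl supl.
have lal : l *m al = 0.
  apply: (mulmx_disjoint supl supal) => a d b /and3P[_ _ pd] /and3P[_ _ dp].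
  by have := lt_trans pd dp; rewrite lt_irr.
have lbe : l *m be = 0 by disjoint I nIp supl supbe.
have lE0 : l *m E = 0 by disjoint I nIp supl supE.
have lr : l *m r = 0.
  apply: (mulmx_disjoint supl supr) => a d b /and3P[_ _ pd] /and3P[_ _ dp].
  by have := lt_trans pd dp; rewrite lt_irr.
have rN : r *m N = 0 by disjoint I nIp supr supN.
have ral : r *m al = 0 by disjoint I nIp supr supal.
have rE0 : r *m E = r.
  apply/matrixP=> a b; rewrite mul_deltaE; case: eqP => [->//|/eqP/negPf bp].
  by rewrite supr // bp andbF.
clearbody l r; pose G := e - l; pose P := e - r - r *m l.
have supXc : supported (lt_on I) (N - al *m l).
  apply: supportedB => //; apply: supportedM supal supl.
  move=> a d b /and3P[aI _ ap] /and3P[_ bI pb].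
  by rewrite /lt_on aI bI (lt_trans ap pb).
have pI' : p \in p |: I by rewrite setU11.
exists G, P; split=> //; split.
- apply: supportedB; [apply: supportedW supe | apply: supportedW supl].
    by move=> a b /and3P[aI bI ab]; rewrite /le_on !inE aI bI ab !orbT.
  by move=> a b /and3P[/eqP-> bI pb]; rewrite /le_on !inE eqxx bI pb !orbT.
- have supP a b : [&& a \in I, b == p & lt a p] || lt_on I a b ||
        [&& a \in I, b \in I & a == b] ->
      le_on (p |: I) a b && (a \in I).
    rewrite /lt_on /le_on !inE => /orP[/orP[]|].
    + by case/and3P=> -> /eqP -> ->; rewrite eqxx !orbT.
    + by case/and3P=> -> -> ->; rewrite !orbT.
    + by case/and3P=> -> -> ->; rewrite !orbT.
  apply: supportedB; first apply: supportedB.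
  + by apply: supportedW supe => a b abI; apply: supP; rewrite abI !orbT.
  + by apply: supportedW supr => a b abI; apply: supP; rewrite abI.
  + apply: supportedM supr supl => a d b /and3P[aI _ ap] /and3P[_ bI pb].
    by apply: supP; rewrite /lt_on aI bI (lt_trans ap pb) orbT.
- rewrite /P /G mulmxBr !mulmxBl ee re el -[r *m l *m e]mulmxA le.
  by rewrite -[r *m l *m l]mulmxA ll mulmx0 !subr0 sub0r opprK subrK.
- have cl : c *: l = be + l *m N by rewrite -lE mulmxBr mul_mx_scalar subrK.
  have -> : Xc *m G = (N - al *m l) + (be - c *: l).
    rewrite /Xc XE /G mulmxBr !mulmxDl Ne ale bee -!scalemxAl Ee scaler0 !addr0.
    by rewrite Nl bel El add0r addr0 opprD addrACA.
  have -> : G *m (N - al *m l) = (N - al *m l) - l *m N.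
    by rewrite /G mulmxBl !mulmxBr eN !mulmxA eal lal mul0mx subr0.
  by rewrite cl opprD [be + _]addrA subrr sub0r.
- have cr : c *: r = al + N *m r by rewrite -rE mulmxBl mul_scalar_mx subrK.
  have rbe : r *m be = c *: (r *m l) - r *m l *m N.
    by rewrite -lE mulmxBr mul_mx_scalar mulmxBr scalemxAr mulmxA.
  have alE : al = c *: r - N *m r by rewrite cr addrK.
  have -> : P *m Xc = N + al - (r *m be + c *: r) - r *m l *m N.
    rewrite /Xc XE /P !mulmxBl !mulmxDr eN eal ebe -!scalemxAr eE scaler0 !addr0.
    rewrite rN ral rE0 !add0r -!(mulmxA r) lal lbe lE0 !mulmx0 scaler0 !addr0.
    by [].
  have -> : (N - al *m l) *m P = N - al *m l - N *m r - N *m r *m l.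
    rewrite /P !mulmxBr !mulmxBl Ne !mulmxA -(mulmxA al) le -(mulmxA al l r) lr.
    by rewrite mulmx0 mul0mx !subr0.
  rewrite rbe alE mulmxBl -scalemxAl !opprD !opprK !addrA.
  move: (N *m r *m l) (r *m l *m N) (N *m r) (r *m l) => m1 m2 m3 m4.
  by apply/matrixP=> i j; rewrite !mxE; ring.
Qed.

(** To reach [Z] on [I], solve the equation for [G Z P'] on [p |: I] and
    compress the solution. *)
Lemma commutator_onto_delete I (p : 'I_n) (c : k) X Y : p \notin I -> c != 0 ->
  supported (lt_on (p |: I)) X -> supported (lt_on (p |: I)) Y ->
  commutator_onto (p |: I) (X + c *: delta_mx p p) (Y + c *: delta_mx p p) ->
  commutator_onto I (delete_point I p c X) (delete_point I p c Y).
Proof.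
move=> pI c0 supX supY onto Z supZ.
have [G [P [[supG supP PG XG PX] _]]] := delete_pointP pI c0 supX.
have [G' [P' [[supG' supP' PG' YG' PY'] _]]] := delete_pointP pI c0 supY.
have idZ e : e = mask (fun a b => (a == b) && (a \in I)) 1%:M ->
    e *m Z = Z /\ Z *m e = Z.
  move=> eE; split; apply/matrixP=> a b; rewrite mxE.
    rewrite (bigD1 a) //= big1 => [|j ja]; rewrite eE !mxE ?eqxx ?addr0 /=.
      by case: ifPn => aI; rewrite ?mul1r ?mul0r // supZ // /lt_on (negPf aI).
    by rewrite eq_sym (negPf ja) mul0r.
  rewrite (bigD1 b) //= big1 => [|j jb]; rewrite eE !mxE ?eqxx ?addr0 /=.
    by case: ifPn => bI; rewrite ?mulr1 ?mulr0 // supZ // /lt_on (negPf bI) andbF.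
  by rewrite (negPf jb) mulr0.
have [|H supH HE] := onto (G *m Z *m P').
  apply: (supportedM (r := fun a b => lt_on (p |: I) a b && (b \in I))) supP'.
    move=> a d b /andP[/and3P[aI _ ad] _] /andP[/and3P[_ bI db] _].
    by rewrite /lt_on aI bI (lt_le_trans ad db).
  apply: supportedM supG supZ => a d b /andP[/and3P[aI dI' ad] dI] /and3P[_ bI db].
  by rewrite /lt_on aI in_setU bI orbT (le_lt_trans ad db).
exists (P *m H *m G').
  apply: (supportedM (r := fun a b => le_on (p |: I) a b && (a \in I))) supG'.
    move=> a d b /andP[/and3P[_ dI ad] aI] /andP[/and3P[_ bI' db] bI].
    by rewrite /le_on aI bI (le_trans ad db).
  apply: supportedM supP supH => a d b /andP[/and3P[aI dI ad] aI'] /and3P[_ bI db].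
  by rewrite /le_on aI bI aI' (le_trans ad db).
transitivity (P *m (G *m Z *m P') *m G').
  rewrite !mulmxA PG -!mulmxA PG'.
  by have [eZ Ze] := idZ _ erefl; rewrite Ze eZ.
by rewrite HE mulmxBr mulmxBl !mulmxA PX -!mulmxA YG' !mulmxA.
Qed.

(** The boolean keeps track of the diagonal case [X = Y]. *)
Definition onto_pair (diag : bool) I : Prop :=
  exists X Y, [/\ diag -> X = Y, supported (lt_on I) X, supported (lt_on I) Y,
    commutator_onto I X Y & commutator_onto I Y X].

(** Only finitely many scalars [c] are bad for one of the two commutator maps;
    any other nonzero [c] splits the point [p] off. *)
Lemma onto_pair_delete diag I (p : 'I_n) : p \notin I ->
  onto_pair diag (p |: I) -> onto_pair diag I.
Proof.
move=> pI [X [Y [XY supX supY ontoXY ontoYX]]].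
have pI' : p \in p |: I by rewrite setU11.
have [P P0 HP] := commutator_onto_generic pI' supX supY ontoXY.
have [Q Q0 HQ] := commutator_onto_generic pI' supY supX ontoYX.
have /closed_nonrootP[c] : 'X * P * Q != 0.
  rewrite !mulf_neq0 ?polyX_eq0 //.
    by apply: contraNneq P0 => ->; rewrite horner0.
  by apply: contraNneq Q0 => ->; rewrite horner0.
rewrite !rootM rootX !negb_or !rootE => /andP[/andP[c0 Pc] Qc].
exists (delete_point I p c X), (delete_point I p c Y); split.
- by move=> /XY ->.
- by have [? [? []]] := delete_pointP pI c0 supX.
- by have [? [? []]] := delete_pointP pI c0 supY.
- exact: commutator_onto_delete (HP c Pc).
- exact: commutator_onto_delete (HQ c Qc).
Qed.

Lemma onto_pair_subset diag I : onto_pair diag setT -> onto_pair diag I.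
Proof.
move=> ontoT; have [j] := ubnP #|~: I|; elim: j I => // j IHj I.
have [|/subsetPn[p _ pI]] := boolP (setT \subset I);
  first by rewrite subTset => /eqP ->.
rewrite (cardsD1 p) inE pI add1n ltnS => ltIj.
apply: (onto_pair_delete pI); apply: IHj.
by apply: leq_trans ltIj; rewrite setCU setIC -setDE.
Qed.

End Poset.

(** * The complex computing extensions *)

Section GradedSpaces.

Variables (k : fieldType) (N : nat) (V : grspace N).

Lemma graded_mx0 v m (A B : 'M[k]_(V v, m)) : ~~ (0 < v <= N)%N -> A = B.
Proof.
by move=> Nv; apply/matrixP=> i; have := ltn_ord i;
  rewrite [X in (_ < X)%N](gdim_out V Nv).
Qed.

Lemma LambdaP (x : datum k V) : Lambda x <->
  forall v, x.2 v *m x.1 v = x.1 v.+1 *m x.2 v.+1.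
Proof.
split=> [Lx v|Lx v _]; last exact: Lx.
by have [/Lx//|Nv] := ltnP v N; apply: graded_mx0; rewrite -ltnNge ltnS.
Qed.

End GradedSpaces.

Section ExtensionComplex.

Variables (k : fieldType) (N : nat) (V : grspace N).
Implicit Types (x y c : datum k V) (h : graded_map k V V).

Definition coboundary x y h : datum k V :=
  (fun v => x.1 v *m h v.+1 - h v *m y.1 v,
   fun v => x.2 v *m h v - h v.+1 *m y.2 v).

(** The derivative of the preprojective relation at the vertex [v.+1]. *)
Definition cocycle_defect x y c (v : nat) : 'M[k]_(V v.+1) :=
  c.2 v *m y.1 v + x.2 v *m c.1 v - c.1 v.+1 *m y.2 v.+1 - x.1 v.+1 *m c.2 v.+1.

Definition datum_eq x y : Prop := forall v, x.1 v = y.1 v /\ x.2 v = y.2 v.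

Definition ext_exact x y : Prop := forall c,
  (forall v, cocycle_defect x y c v = 0) ->
  exists h, datum_eq c (coboundary x y h).

Lemma cocycle_coboundary x y h v : Lambda x -> Lambda y ->
  cocycle_defect x y (coboundary x y h) v = 0.
Proof.
move=> /LambdaP Lx /LambdaP Ly; rewrite /cocycle_defect /=.
rewrite !mulmxBl !mulmxBr !mulmxA Lx -(mulmxA (h v.+1)) Ly !mulmxA.
move: (x.2 v *m h v *m y.1 v) (_ *m y.1 v.+1 *m y.2 v.+1) => m1 m2.
move: (x.1 v.+1 *m x.2 v.+1 *m h v.+1) (x.1 v.+1 *m h v.+2 *m y.2 v.+1) => m3 m4.
by apply/matrixP=> i j; rewrite !mxE; ring.
Qed.

(** A cocycle is the off-diagonal block of an extension whose underlying graded
    space is the direct sum; a splitting is a cochain bounding it. *)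
Lemma Ext1_zero_exact x y : Lambda x -> Lambda y -> Ext1_zero x y -> ext_exact x y.
Proof.
move=> /LambdaP Lx /LambdaP Ly ext0 c c0; pose E := dsum_space V V.
pose z : datum k E := (fun v => block_mx (y.1 v) 0 (c.1 v) (x.1 v),
                       fun v => block_mx (y.2 v) 0 (c.2 v) (x.2 v)).
pose f : graded_map k V E := fun v => row_mx 1%:M 0.
pose g : graded_map k E V := fun v => col_mx 0 1%:M.
have Lz : Lambda z.
  move=> v _ /=; rewrite !mulmx_block !mulmx0 !mul0mx !addr0 !add0r Lx Ly.
  congr block_mx; apply/eqP; rewrite -subr_eq0 opprD addrA; apply/eqP.
  exact: c0.
have [|h /= hom_h hg] := ext0 E z f g Lz.
  split=> v.
  - by rewrite /= !mul_mx_row !mul_row_block !mulmx1 !mulmx0 !mul1mx !mul0mx !addr0.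
  - by rewrite /= !mul_block_col !mul_col_mx !mulmx1 !mulmx0 !mul1mx !mul0mx !add0r.
  split.
  - by apply/row_freeP; exists (col_mx 1%:M 0);
    rewrite mul_row_col mulmx1 mulmx0 addr0.
  - by apply/row_fullP; exists (row_mx 0 1%:M);
    rewrite mul_row_col mulmx1 mulmx0 add0r.
  apply/andP; split.
    by rewrite sub_kermx mul_row_col mulmx1 mulmx0 addr0.
  apply/row_subP => i; set u := row i _.
  have : u *m g v = 0 by apply/sub_kermxP; apply: row_sub.
  rewrite -[u]hsubmxK mul_row_col mulmx1 mulmx0 add0r => ->.
  by apply/submxP; exists (lsubmx u); rewrite mul_mx_row mulmx1 mulmx0.
have [l hE] : exists l : graded_map k V V, forall v, h v = row_mx (l v) 1%:M.
  exists (fun v => lsubmx (h v)) => v; rewrite -[LHS]hsubmxK; congr row_mx.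
  by have := hg v; rewrite -{1}[h v]hsubmxK mul_row_col mulmx0 mulmx1 add0r.
exists l => v /=; have [] := hom_h v; rewrite !hE.
rewrite !mul_row_block !mul_mx_row !mul1mx !mulmx1 !mulmx0 !add0r.
by move=> /eq_row_mx[-> _] /eq_row_mx[-> _]; rewrite ![l _ *m _ + _]addrC !addrK.
Qed.

(** A graded section [s] of an extension is a homomorphism up to a cocycle, and
    correcting it by a bounding cochain gives a splitting. *)
Lemma exact_Ext1_zero x y : Lambda x -> Lambda y -> ext_exact x y -> Ext1_zero x y.
Proof.
move=> /LambdaP Lx /LambdaP Ly ex E z f g /LambdaP Lz [hom_f hom_g exact_fg].
have fI v : f v *m pinvmx (f v) = 1%:M by apply: mulmxVp; case: (exact_fg v).
have fgK v m (A : 'M[k]_(m, E v)) : A *m g v = 0 -> A *m pinvmx (f v) *m f v = A.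
  move=> Ag; apply: mulmxKpV; have [_ _ /eqmxP fg] := exact_fg v.
  by rewrite fg sub_kermx Ag.
have [s gI] : exists s : graded_map k V E, forall v, s v *m g v = 1%:M.
  by exists (fun v => pinvmx (g v)) => v; apply: mulVpmx; case: (exact_fg v).
have [c c1 c2] : exists2 c : datum k V,
    forall v, c.1 v *m f v.+1 = s v *m z.1 v - x.1 v *m s v.+1 &
    forall v, c.2 v *m f v = s v.+1 *m z.2 v - x.2 v *m s v.
  exists (fun v => (s v *m z.1 v - x.1 v *m s v.+1) *m pinvmx (f v.+1),
          fun v => (s v.+1 *m z.2 v - x.2 v *m s v) *m pinvmx (f v)) => v;
    apply: fgK; rewrite mulmxBl -!mulmxA ?(proj1 (hom_g v)) ?(proj2 (hom_g v)) gI;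
    by rewrite mulmx1 mulmxA gI mul1mx subrr.
have [v|h hE] := ex c.
  rewrite -[LHS]mulmx1 -(fI v.+1) mulmxA [X in X *m _](_ : _ = 0) ?mul0mx //.
  rewrite /cocycle_defect !mulmxBl mulmxDl -!mulmxA (proj1 (hom_f _)) (proj2 (hom_f _)).
  rewrite c1 c2 ![c.1 _ *m _]mulmxA ![c.2 _ *m _]mulmxA c1 c2.
  rewrite !mulmxBl !mulmxBr !mulmxA -(mulmxA (s v.+1)) Lz -(mulmxA (x.2 v)) !mulmxA Lx.
  move: (_ *m z.1 v.+1 *m z.2 v.+1) (_ *m z.1 v) => m1 m2.
  move: (_ *m x.2 v.+1 *m s v.+1) (_ *m s v.+2 *m z.2 v.+1) => m3 m4.
  by apply/matrixP=> i j; rewrite !mxE; ring.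
have fg0 v : f v *m g v = 0.
  by apply/sub_kermxP; have [_ _ /eqmxP <-] := exact_fg v.
exists (fun v => s v + h v *m f v) => v; last first.
  by rewrite mulmxDl gI -mulmxA fg0 mulmx0 addr0.
have [h1 h2] := hE v; have := c1 v; have := c2 v; rewrite h1 h2 /=.
rewrite !mulmxBl -!mulmxA (proj1 (hom_f v)) (proj2 (hom_f v)) !mulmxA => hB hT.
have swap (U : zmodType) (A B C D : U) : A - B = C - D -> D + A = C + B.
  by move=> /eqP; rewrite subr_eq addrAC eq_sym subr_eq => /eqP ->; rewrite addrC.
by split; rewrite mulmxDr mulmxDl !mulmxA; apply: swap.
Qed.

(** Bilinear form for which the coboundary of the pair [(y, x)] is adjoint to the
    cocycle defect of [(x, y)]. *)
Definition cochain_pairing c c' : k :=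
  \sum_(v < N.+1) (\tr (c.2 v *m c'.1 v) - \tr (c.1 v *m c'.2 v)).

Lemma pairing_coboundary x y c h :
  cochain_pairing c (coboundary y x h) =
  \sum_(v < N.+1) \tr (cocycle_defect x y c v *m h v.+1).
Proof.
pose C v := \tr (c.1 v *m y.2 v *m h v) + \tr (x.1 v *m c.2 v *m h v).
have C0 v : ~~ (0 < v <= N)%N -> C v = 0.
  move=> Nv; rewrite /C (graded_mx0 (c.1 v) 0 Nv) (graded_mx0 (x.1 v) 0 Nv).
  by rewrite !mul0mx mxtrace0 addr0.
have tel m : \sum_(v < m) (C v.+1 - C v) = C m.
  elim: m => [|m IHm]; first by rewrite big_ord0 C0.
  by rewrite big_ord_recr IHm /= addrC subrK.
apply/eqP; rewrite -subr_eq0 -sumrB; apply/eqP.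
have Cm : C N.+1 = 0 by rewrite C0 // ltnn andbF.
rewrite -[RHS]Cm -tel; apply: eq_bigr => v _.
rewrite /cocycle_defect /C /= !mulmxBr !mulmxBl mulmxDl !raddfB raddfD /= !mulmxA.
rewrite [\tr (c.2 v *m h v *m x.1 v)]mxtrace_mulC mulmxA.
rewrite [\tr (c.1 v *m h v.+1 *m x.2 v)]mxtrace_mulC mulmxA.
ring.
Qed.

Lemma mxtrace_delta p q (A : 'M[k]_(p, q)) i j : \tr (delta_mx j i *m A) = A i j.
Proof.
rewrite /mxtrace (bigD1 j) //= big1 => [|l lj].
  rewrite mxE (bigD1 i) //= big1 => [|m mi]; rewrite !mxE ?eqxx ?mul1r ?addr0 //.
  by rewrite (negPf mi) mul0r.
by rewrite mxE big1 // => m _; rewrite mxE (negPf lj) mul0r.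
Qed.

Lemma pairing_nondegenerate c c' :
  (forall c'', cochain_pairing c'' c = cochain_pairing c'' c') -> datum_eq c c'.
Proof.
move=> cc'.
pose d p q i j : 'M[k]_(p, q) :=
  \matrix_(a, b) ((a == i :> nat) && (b == j :> nat))%:R.
have dE p q (i : 'I_p) (j : 'I_q) : d p q i j = delta_mx i j.
  by apply/matrixP=> a b; rewrite !mxE.
have pick v (F : nat -> k) : (v < N.+1)%N ->
    (forall w, w != v -> F w = 0) -> \sum_(w < N.+1) F w = F v.
  move=> vN F0; rewrite (bigD1 (Ordinal vN)) //= big1 ?addr0 // => w wv.
  exact: F0.
move=> v; split; have [Nv|vN] := ltnP N v.
- by apply: graded_mx0; rewrite (leqNgt v N) Nv andbF.
- apply/matrixP=> i j.
  pose c'' : datum k V := (fun=> 0, fun w => if w == v then d _ _ j i else 0).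
  suff E e : cochain_pairing c'' e = e.1 v i j by rewrite -!E.
  rewrite /cochain_pairing (pick v
    (fun w => \tr (c''.2 w *m e.1 w) - \tr (c''.1 w *m e.2 w))) => [||w /negPf wv] //;
    rewrite /c'' /=.
    by rewrite eqxx mul0mx mxtrace0 subr0 dE mxtrace_delta.
  by rewrite wv !mul0mx !mxtrace0 subrr.
- apply/matrixP=> i; have := ltn_ord i; rewrite [X in (_ < X)%N]gdim_out //.
  by rewrite ltnS ltnNge (ltnW Nv).
apply/matrixP=> i j.
pose c'' : datum k V := (fun w => if w == v then d _ _ j i else 0, fun=> 0).
suff E e : cochain_pairing c'' e = - e.2 v i j.
  by apply: oppr_inj; rewrite -!E.
rewrite /cochain_pairing (pick v
    (fun w => \tr (c''.2 w *m e.1 w) - \tr (c''.1 w *m e.2 w))) => [||w /negPf wv] //;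
    rewrite /c'' /=.
  by rewrite eqxx mul0mx mxtrace0 sub0r dE mxtrace_delta.
by rewrite wv !mul0mx !mxtrace0 subrr.
Qed.

End ExtensionComplex.

Section Coordinates.

Variables (k : fieldType) (N : nat) (V : grspace N).
Implicit Types (x y c : datum k V) (h : graded_map k V V).

(** All the spaces [V v] are embedded, independently of each other, in one space
    of row vectors, so that cochains become matrices of a single size. *)
Let width : nat := \sum_(v < N.+1) V v.
Let total : nat := (N.+1 * width)%N.

Definition vertex_in (v : nat) : 'M[k]_(V v, total) :=
  \matrix_(i, c) (c == (v * width + i)%N :> nat)%:R.

Lemma vertex_inE v w (i : 'I_(V v)) (j : 'I_(V w)) :
  (vertex_in v *m (vertex_in w)^T) i j = ((v == w) && (i == j :> nat))%:R.
Proof.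
have bound u (l : 'I_(V u)) : (l < width)%N /\ (u < N.+1)%N.
  have uN : (u < N.+1)%N.
    rewrite ltnS leqNgt; apply/negP=> Nu; have := ltn_ord l.
    by rewrite [X in (_ < X)%N]gdim_out // (leqNgt u N) Nu andbF.
  split=> //; apply: leq_trans (ltn_ord l) _.
  by rewrite /width (bigD1 (Ordinal uN)) //= leq_addr.
have [[il vN] [jl wN]] := (bound _ i, bound _ j).
have lt_tot : (v * width + i < total)%N.
  by rewrite /total; apply: (@leq_trans (v.+1 * width));
    rewrite ?leq_mul2r ?vN ?orbT // mulSn addnC ltn_add2r.
have -> : (v == w) && (i == j :> nat) = (v * width + i == w * width + j)%N.
  apply/andP/eqP => [[/eqP vw /eqP ->] | eq_ij].
    by congr (_ * _ + _)%N.
  have := congr1 (modn^~ width) eq_ij; have := congr1 (divn^~ width) eq_ij.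
  have w0 : (0 < width)%N by apply: leq_ltn_trans il.
  by rewrite !divnMDl // !divn_small // !addn0 !modnMDl !modn_small // => /eqP vw /eqP ij.
rewrite mxE (bigD1 (Ordinal lt_tot)) //= big1 => [|l ll]; rewrite !mxE /=.
  by rewrite eqxx mul1r addr0.
by rewrite -(inj_eq val_inj) /= in ll; rewrite (negPf ll) mul0r.
Qed.

Lemma vertex_inK v : vertex_in v *m (vertex_in v)^T = 1%:M.
Proof. by apply/matrixP=> i j; rewrite vertex_inE mxE eqxx. Qed.

Lemma vertex_in0 v w : v != w -> vertex_in v *m (vertex_in w)^T = 0.
Proof. by move=> /negPf vw; apply/matrixP=> i j; rewrite vertex_inE vw mxE. Qed.

Definition block_in v w (A : 'M[k]_(V v, V w)) : 'M[k]_total :=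
  (vertex_in v)^T *m A *m vertex_in w.

Definition block_out v w (C : 'M[k]_total) : 'M[k]_(V v, V w) :=
  vertex_in v *m C *m (vertex_in w)^T.

Lemma block_in_linear v w : linear (@block_in v w).
Proof.
by move=> a A B; rewrite /block_in mulmxDr mulmxDl -scalemxAr -scalemxAl.
Qed.

Lemma block_out_linear v w : linear (@block_out v w).
Proof.
by move=> a A B; rewrite /block_out mulmxDr mulmxDl -scalemxAr -scalemxAl.
Qed.

Lemma block_outD v w C C' :
  block_out v w (C + C') = block_out v w C + block_out v w C'.
Proof. by rewrite /block_out mulmxDr mulmxDl. Qed.

Lemma block_inK v w (A : 'M[k]_(V v, V w)) : block_out v w (block_in A) = A.
Proof.
rewrite /block_out /block_in !mulmxA vertex_inK mul1mx.
by rewrite -mulmxA vertex_inK mulmx1.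
Qed.

Lemma block_in0 v w v' w' (A : 'M[k]_(V v, V w)) :
  (v != v') || (w != w') -> block_out v' w' (block_in A) = 0.
Proof.
rewrite /block_out /block_in !mulmxA; case: (eqVneq v v') => [<- /= ww'|vv' _].
  by rewrite -mulmxA (vertex_in0 ww') mulmx0.
by rewrite vertex_in0 1?eq_sym // !mul0mx.
Qed.

Lemma block_out_sum v w m l (F : nat -> 'M[k]_total) (A : 'M[k]_(V v, V w)) :
  (l < m)%N -> block_out v w (F l) = A ->
  (forall u, u != l -> block_out v w (F u) = 0) ->
  block_out v w (\sum_(u < m) F u) = A.
Proof.
move=> lm Fl F0; rewrite (bigD1 (Ordinal lm)) //=.
rewrite block_outD Fl -[RHS]addr0; congr (_ + _).
apply: (big_ind (fun C => block_out v w C = 0)) => [||u uv]; last exact: F0.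
  by rewrite /block_out mulmx0 mul0mx.
by move=> C C' C0 C'0; rewrite block_outD C0 C'0 addr0.
Qed.

Definition graded_of (C : 'M[k]_total) : graded_map k V V :=
  fun v => block_out v v C.

Definition datum_of (C : 'M[k]_total) : datum k V :=
  (fun v => block_out v v.+1 C, fun v => block_out v.+1 v C).

Definition mx_of_datum c : 'M[k]_total :=
  \sum_(v < N.+2) (block_in (c.1 v) + block_in (c.2 v)).

Definition mx_of_defect (u : forall v, 'M[k]_(V v.+1, V v.+1)) : 'M[k]_total :=
  \sum_(v < N.+2) block_in (u v).

Lemma datum_ofK c : datum_eq (datum_of (mx_of_datum c)) c.
Proof.
move=> v; split=> /=; have [vN|Nv] := ltnP v N.+2.
- apply: (block_out_sum (l := v)
    (F := fun v => block_in (c.1 v) + block_in (c.2 v))) => // [|u /eqP uv].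
    by rewrite block_outD block_inK block_in0 ?addr0 //; lia.
  by rewrite block_outD !block_in0 ?addr0 //; lia.
- by apply: graded_mx0; lia.
- apply: (block_out_sum (l := v)
    (F := fun v => block_in (c.1 v) + block_in (c.2 v))) => // [|u /eqP uv].
    by rewrite block_outD block_inK block_in0 ?add0r //; lia.
  by rewrite block_outD !block_in0 ?addr0 //; lia.
- by apply: graded_mx0; lia.
Qed.

Lemma defect_ofK (u : forall v, 'M[k]_(V v.+1, V v.+1)) v :
  block_out v.+1 v.+1 (mx_of_defect u) = u v.
Proof.
have [vN|Nv] := ltnP v N.+2.
  apply: (block_out_sum (l := v) (F := fun v => block_in (u v))) => // [|l /eqP lv].
    by rewrite block_inK.
  by rewrite block_in0 //; lia.
by apply: graded_mx0; lia.
Qed.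

Definition coboundary_mx x y (C : 'M[k]_total) : 'M[k]_total :=
  mx_of_datum (coboundary x y (graded_of C)).

(** The second block vanishes exactly on the matrices that encode a cochain, so
    that exactness at the matrices encoding cochains becomes plain exactness. *)
Definition defect_mx x y (C : 'M[k]_total) : 'M[k]_(total, total + total) :=
  row_mx (mx_of_defect (cocycle_defect x y (datum_of C)))
         (C - mx_of_datum (datum_of C)).

Lemma coboundary_mx_linear x y : linear (coboundary_mx x y).
Proof.
move=> a A B; rewrite /coboundary_mx /mx_of_datum scaler_sumr -big_split.
apply: eq_bigr => v _ /=; rewrite /graded_of !block_out_linear.
rewrite !mulmxDr !mulmxDl -!scalemxAr -!scalemxAl.
have e (U : lmodType k) (P Q P' Q' : U) :
    a *: P + Q - (a *: P' + Q') = a *: (P - P') + (Q - Q').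
  by rewrite scalerBr opprD addrACA.
by rewrite !e !block_in_linear scalerDr addrACA.
Qed.

Lemma mx_of_datum_of_linear : linear (fun C => mx_of_datum (datum_of C)).
Proof.
move=> a A B; rewrite /mx_of_datum scaler_sumr -big_split.
apply: eq_bigr => v _ /=; rewrite !block_out_linear !block_in_linear.
by rewrite scalerDr addrACA.
Qed.

Lemma defect_mx_linear x y : linear (defect_mx x y).
Proof.
move=> a A B; rewrite /defect_mx scale_row_mx add_row_mx; congr row_mx; last first.
  by rewrite mx_of_datum_of_linear scalerBr opprD addrACA.
rewrite /mx_of_defect scaler_sumr -big_split; apply: eq_bigr => v _ /=.
rewrite -block_in_linear; congr block_in;
  rewrite /cocycle_defect /= !block_out_linear.
rewrite !mulmxDr !mulmxDl -!scalemxAr -!scalemxAl !scalerBr scalerDr.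
by apply/matrixP=> i j; rewrite !mxE; ring.
Qed.

Lemma graded_of_surj h : exists C, forall v, graded_of C v = h v.
Proof.
exists (\sum_(v < N.+2) block_in (h v)) => v.
have [vN|Nv] := ltnP v N.+2.
  apply: (block_out_sum (l := v) (F := fun v => block_in (h v))) => // [|u /eqP uv].
    by rewrite block_inK.
  by rewrite block_in0 //; lia.
by apply: graded_mx0; lia.
Qed.

Lemma mx_of_datum_eq c c' : datum_eq c c' -> mx_of_datum c = mx_of_datum c'.
Proof. by move=> cc'; apply: eq_bigr => v _; have [-> ->] := cc' v. Qed.

Lemma defect_mx0 x y C : defect_mx x y C = 0 <->
  (forall v, cocycle_defect x y (datum_of C) v = 0) /\
  C = mx_of_datum (datum_of C).
Proof.
rewrite /defect_mx -row_mx0; split=> [/eq_row_mx[d0 /eqP]|[d0 CE]].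
  rewrite subr_eq0 => /eqP CE; split=> // v.
  by rewrite -defect_ofK d0 /block_out mulmx0 mul0mx.
congr row_mx; last by rewrite {1}CE subrr.
rewrite /mx_of_defect big1 // => v _.
by rewrite d0 /block_in mulmx0 mul0mx.
Qed.

Lemma cocycle_defect_eq x y c c' : datum_eq c c' ->
  forall v, cocycle_defect x y c v = cocycle_defect x y c' v.
Proof.
by move=> cc' v; rewrite /cocycle_defect; have [-> ->] := cc' v;
  have [-> ->] := cc' v.+1.
Qed.

Lemma ext_exact_mx x y : ext_exact x y <->
  forall C, defect_mx x y C = 0 -> exists B, C = coboundary_mx x y B.
Proof.
split=> [ex C /defect_mx0[C0 CE] | ex c c0].
  have [h hE] := ex _ C0; have [B BE] := graded_of_surj h.
  exists B; rewrite CE; apply: mx_of_datum_eq => v.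
  by have [-> ->] := hE v; rewrite /= !BE.
have [|B BE] := ex (mx_of_datum c).
  apply/defect_mx0; split; last by apply/esym/mx_of_datum_eq/datum_ofK.
  by move=> v; rewrite (cocycle_defect_eq _ _ (datum_ofK c)).
exists (graded_of B) => v; have [<- <-] := datum_ofK c v; rewrite BE.
exact: datum_ofK.
Qed.

Lemma defect_coboundary_mx x y B : Lambda x -> Lambda y ->
  defect_mx x y (coboundary_mx x y B) = 0.
Proof.
move=> Lx Ly; apply/defect_mx0; split.
  by move=> v; rewrite (cocycle_defect_eq _ _ (datum_ofK _)) cocycle_coboundary.
by apply/esym/mx_of_datum_eq/datum_ofK.
Qed.

Lemma ext_exact_open (Omega : Type) (P : (Omega -> k) -> Prop)
    (xf yf : Omega -> datum k V) (w0 : Omega) :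
  function_ring P ->
  (forall v, regular_mx P (fun w => (xf w).1 v)) ->
  (forall v, regular_mx P (fun w => (xf w).2 v)) ->
  (forall v, regular_mx P (fun w => (yf w).1 v)) ->
  (forall v, regular_mx P (fun w => (yf w).2 v)) ->
  ext_exact (xf w0) (yf w0) ->
  exists F, [/\ P F, F w0 != 0 & forall w, F w != 0 ->
    Lambda (xf w) -> Lambda (yf w) -> ext_exact (xf w) (yf w)].
Proof.
move=> PR x1 x2 y1 y2 /ext_exact_mx ex0.
have [||||F [PF F0 HF]] := open_exact PR (f0 := fun w => coboundary_mx (xf w) (yf w))
    (f1 := fun w => defect_mx (xf w) (yf w)) _ _ _ _ ex0.
- by move=> w; apply: coboundary_mx_linear.
- by move=> w; apply: defect_mx_linear.
- move=> C; apply: regular_sum => // v; apply: regular_add => //; do 2!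
    [apply: regular_mul => //; try exact: regular_const];
    apply: regular_sub => //; apply: regular_mul => //; exact: regular_const.
- move=> C; apply: regular_row_mx => //; last exact: regular_const.
  apply: regular_sum => // v; do 2! [apply: regular_mul => //; try exact: regular_const].
  apply: regular_sub => //; last by apply: regular_mul => //; exact: regular_const.
  apply: regular_sub => //; last by apply: regular_mul => //; exact: regular_const.
  by apply: regular_add => //; apply: regular_mul => //; exact: regular_const.
exists F; split=> // w Fw Lx Ly; apply/ext_exact_mx; apply: HF => // B.
exact: defect_coboundary_mx.
Qed.

(** A functional killing the kernel of [f] factors through [f], and every
    functional on matrices is a trace form. *)
Lemma functional_factor a b p q (f : 'M[k]_(a, b) -> 'M[k]_(p, q))
    (phi : 'M[k]_(a, b) -> 'M[k]_1) :
  linear f -> linear phi -> (forall A, f A = 0 -> phi A = 0) ->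
  exists h : 'M[k]_(q, p), forall A, phi A 0 0 = \tr (f A *m h).
Proof.
move=> f_lin phi_lin f0.
pose M := lin_mx f; pose g := lin_mx phi.
have Mg : (1%:M - M *m pinvmx M) *m g = 0.
  apply/row_matrixP => i; rewrite row0 row_mul -[row i _]vec_mxK lin_mxE //.
  rewrite f0 ?linear0 //; apply: (can_inj mxvecK);
    rewrite -lin_mxE // vec_mxK linear0.
  rewrite -/M -row_mul mulmxBl mul1mx mulmxKpV ?subrr ?row0 //.
have [d Hd] : exists d, g = M *m d.
  by exists (pinvmx M *m g); apply/eqP;
    rewrite mulmxA -subr_eq0 -{1}[g]mul1mx -mulmxBl Mg.
pose psi (B : 'M[k]_(p, q)) := vec_mx (mxvec B *m d) 0 0 : k.
exists (\matrix_(j, i) psi (delta_mx i j)) => A.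
have -> : phi A 0 0 = psi (f A).
  by rewrite /psi -lin_mxE // -mulmxA -Hd lin_mxE // mxvecK.
rewrite /psi {1}[f A]matrix_sum_delta !linear_sum mulmx_suml linear_sum summxE.
rewrite /mxtrace; apply: eq_bigr => i _; rewrite [RHS]mxE !linear_sum mulmx_suml.
rewrite linear_sum summxE; apply: eq_bigr => j _.
by rewrite !linearZ -scalemxAl linearZ [LHS]mxE [X in _ = _ * X]mxE.
Qed.

Lemma pairing_antisym c c' : cochain_pairing c c' = - cochain_pairing c' c.
Proof.
rewrite /cochain_pairing -sumrN; apply: eq_bigr => v _.
by rewrite opprB [\tr (c.2 v *m _)]mxtrace_mulC [\tr (c.1 v *m _)]mxtrace_mulC.
Qed.

Lemma pairing_eql c c' c'' : datum_eq c c' ->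
  cochain_pairing c c'' = cochain_pairing c' c''.
Proof. by move=> cc'; apply: eq_bigr => v _; have [-> ->] := cc' v. Qed.

(** The complex of [(y, x)] is dual to that of [(x, y)]: this is where the
    two-dimensional Calabi-Yau nature of preprojective algebras enters. A cocycle
    [c] of [(y, x)] defines a functional on the cochains of [(x, y)] that kills
    the coboundaries, hence the cocycles; it is then a function of the defect,
    and the trace pairing turns this function into a cochain bounding [c]. *)
Lemma ext_exact_sym x y : ext_exact x y -> ext_exact y x.
Proof.
move=> /ext_exact_mx ex c c0.
pose phi C : 'M[k]_1 := (cochain_pairing (datum_of C) c)%:M.
have phi_lin : linear phi.
  move=> a A B; rewrite /phi scale_scalar_mx -raddfD; congr _%:M.
  rewrite /cochain_pairing mulr_sumr -big_split; apply: eq_bigr => v _ /=.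
  rewrite !block_out_linear !mulmxDl -!scalemxAl !mxtraceD !mxtraceZ.
  ring.
have [|h hE] := functional_factor (@defect_mx_linear x y) phi_lin.
  move=> C C0; have [B CE] := ex C C0; rewrite /phi; apply/matrixP=> i j.
  rewrite CE (pairing_eql _ (datum_ofK _)) pairing_antisym pairing_coboundary.
  by rewrite big1 ?oppr0 ?mxE ?mul0rn // => v _; rewrite c0 mul0mx mxtrace0.
exists (graded_of (usubmx h)); apply: pairing_nondegenerate => c'.
have := hE (mx_of_datum c');
  rewrite /phi mxE mulr1n (pairing_eql _ (datum_ofK c')) => ->.
rewrite pairing_coboundary /defect_mx -[h]vsubmxK mul_row_col raddfD /=.
rewrite (mx_of_datum_eq (datum_ofK c')) subrr mul0mx mxtrace0 addr0 col_mxKu.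
rewrite /mx_of_defect mulmx_suml raddf_sum big_ord_recr /= [X in _ + X](_ : _ = 0).
  rewrite addr0; apply: eq_bigr => v _.
  rewrite (cocycle_defect_eq _ _ (datum_ofK c')) /block_in /graded_of /block_out.
  by rewrite -!mulmxA mxtrace_mulC -!mulmxA.
rewrite /block_in (graded_mx0 (cocycle_defect _ _ _ _) 0); last by lia.
by rewrite mulmx0 !mul0mx mxtrace0.
Qed.

End Coordinates.

(** * Sums of segments through a common vertex *)

Lemma constant_on_interval (U : Type) (u : nat -> U) m M :
  (forall v, (m <= v < M)%N -> u v = u v.+1) ->
  forall v w, (m <= v <= M)%N -> (m <= w <= M)%N -> u v = u w.
Proof.
move=> step.
have base v : (m <= v <= M)%N -> u v = u m.
  elim: v => [|v IHv] vM; first by congr u; lia.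
  have [mv|mv] := leqP m v; last by congr u; lia.
  by rewrite -step ?IHv //; lia.
by move=> v w /base -> /base ->.
Qed.

Section Segments.

Variables (k : fieldType) (n : nat) (lo hi : 'I_n -> nat) (c : nat).
Hypothesis lo_gt0 : forall i, (0 < lo i)%N.
Hypothesis lo_le : forall i, (lo i <= c)%N.
Hypothesis hi_ge : forall i, (c <= hi i)%N.

Definition alive (i : 'I_n) (v : nat) : bool := (lo i <= v <= hi i)%N.

Definition seg_lt (a b : 'I_n) : bool := (lo b < lo a)%N && (hi b < hi a)%N.
Definition seg_le (a b : 'I_n) : bool := (lo b <= lo a)%N && (hi b <= hi a)%N.

(** The entries [u v] at [(a, b)] of the components of a map lowering the degree
    agree at all vertices where they make sense, and the relation at the first or
    last of these kills them unless [b] both starts and ends before [a]. *)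
Lemma lowering_chain (a b : 'I_n) (u : nat -> k) :
  (forall v, ~~ (alive a v.+1 && alive b v) -> u v = 0) ->
  (forall v, (if alive b v.+1 then u v else 0) =
             (if alive a v.+1 then u v.+1 else 0)) ->
  (~~ seg_lt a b -> forall v, u v = 0) /\
  (forall v, alive a v.+1 -> alive b v -> u v = u c).
Proof.
rewrite /alive /seg_lt => u0 rel.
have := (lo_gt0 a, lo_gt0 b, lo_le a, lo_le b); have := (hi_ge a, hi_ge b).
move: (lo a) (lo b) (hi a) (hi b) u0 rel => la lb ha hb u0 rel.
case=> ca cb [[[la0 lb0] lac] lbc].
have cst := @constant_on_interval _ u (maxn la.-1 lb) (minn hb ha.-1).
have {}cst v w : (la <= v.+1 <= ha)%N -> (lb <= v <= hb)%N ->
    (la <= w.+1 <= ha)%N -> (lb <= w <= hb)%N -> u v = u w.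
  move=> *; apply: cst; try lia.
  by move=> l ll; have := rel l; rewrite !ifT //; lia.
have zero : ~~ ((lb < la) && (hb < ha))%N -> forall v, u v = 0.
  move=> nlt v;
    have [/andP[av bv]|/u0//] := boolP ((la <= v.+1 <= ha) && (lb <= v <= hb))%N.
  have [le_ab|lt_ba] := leqP la lb.
    rewrite (cst v lb); try lia.
    have <- : u lb.-1 = u lb by have := rel lb.-1; rewrite prednK // !ifT //; lia.
    by apply: u0; lia.
  rewrite (cst v ha.-1); try lia.
  have -> : u ha.-1 = u ha by have := rel ha.-1; rewrite prednK ?ifT //; lia.
  by apply: u0; lia.
split=> // v av bv; have [/andP[lt1 lt2]|nlt] := boolP ((lb < la) && (hb < ha))%N.
  by apply: cst; lia.
by rewrite !zero.
Qed.

(** The analogous statement for a map preserving the degree. *)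
Lemma hom_chain (a b : 'I_n) (u : nat -> k) :
  (forall v, ~~ (alive a v && alive b v) -> u v = 0) ->
  (forall v, (if alive a v then u v.+1 else 0) =
             (if alive b v.+1 then u v else 0)) ->
  (~~ seg_le a b -> forall v, u v = 0) /\
  (forall v, alive a v -> alive b v -> u v = u c).
Proof.
rewrite /alive /seg_le => u0 rel.
have := (lo_gt0 a, lo_gt0 b, lo_le a, lo_le b); have := (hi_ge a, hi_ge b).
move: (lo a) (lo b) (hi a) (hi b) u0 rel => la lb ha hb u0 rel.
case=> ca cb [[[la0 lb0] lac] lbc].
have cst := @constant_on_interval _ u (maxn la lb) (minn hb ha).
have {}cst v w : (la <= v <= ha)%N -> (lb <= v <= hb)%N ->
    (la <= w <= ha)%N -> (lb <= w <= hb)%N -> u v = u w.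
  move=> *; apply: cst; try lia.
  by move=> l ll; have := rel l; rewrite !ifT //; lia.
split=> [nle v|v av bv]; last by apply: cst; lia.
have [/andP[av bv]|/u0//] := boolP ((la <= v <= ha) && (lb <= v <= hb))%N.
have [lt_ab|le_ba] := ltnP la lb.
  rewrite (cst v lb); try lia.
  have -> : u lb = u lb.-1 by have := rel lb.-1; rewrite prednK // !ifT //; lia.
  by apply: u0; lia.
rewrite (cst v ha); try lia.
have <- : u ha.+1 = u ha by have := rel ha; rewrite !ifT //; lia.
by apply: u0; lia.
Qed.

Definition alive_mx (v : nat) : 'M[k]_n := \matrix_(a, b) ((a == b) && alive a v)%:R.

Lemma alive_mulE v p (M : 'M[k]_(n, p)) a b :
  (alive_mx v *m M) a b = if alive a v then M a b else 0.
Proof.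
rewrite mxE (bigD1 a) //= big1 => [|j /negPf ja]; rewrite mxE ?eqxx.
  by case: alive; rewrite ?mul1r ?mul0r addr0.
by rewrite eq_sym ja mul0r.
Qed.

Lemma mul_aliveE v p (M : 'M[k]_(p, n)) a b :
  (M *m alive_mx v) a b = if alive b v then M a b else 0.
Proof.
rewrite mxE (bigD1 b) //= big1 => [|j /negPf jb]; rewrite mxE ?eqxx.
  by case: alive; rewrite ?mulr1 ?mulr0 addr0.
by rewrite jb mulr0.
Qed.

Section Frames.

Variables (N : nat) (V : grspace N).

(** Coordinates in which a representation is the sum of the given segments: the
    basis vector [i] lives at the vertices where the segment [i] does, and is
    carried to itself by the arrows inside the segment. *)
Definition frame (T : fwd_maps k V) (io : forall v, 'M[k]_(V v, n))
    (pr : forall v, 'M[k]_(n, V v)) : Prop :=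
  forall v, [/\ io v *m pr v = 1%:M, pr v *m io v = alive_mx v
             & T v = io v *m pr v.+1].

Section TwoFrames.

Variables (T T' : fwd_maps k V).
Variables (io io' : forall v, 'M[k]_(V v, n)) (pr pr' : forall v, 'M[k]_(n, V v)).
Hypotheses (fr : frame T io pr) (fr' : frame T' io' pr').

Let ioK v : io v *m pr v = 1%:M. Proof. by case: (fr v). Qed.
Let prK v : pr v *m io v = alive_mx v. Proof. by case: (fr v). Qed.
Let TE v : T v = io v *m pr v.+1. Proof. by case: (fr v). Qed.
Let ioK' v : io' v *m pr' v = 1%:M. Proof. by case: (fr' v). Qed.
Let prK' v : pr' v *m io' v = alive_mx v. Proof. by case: (fr' v). Qed.
Let TE' v : T' v = io' v *m pr' v.+1. Proof. by case: (fr' v). Qed.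

Lemma sandwichK v w (A : 'M[k]_(V v, V w)) :
  io v *m (pr v *m A *m io' w) *m pr' w = A.
Proof. by rewrite !mulmxA ioK mul1mx -mulmxA ioK' mulmx1. Qed.

Lemma sandwich_alive v w (A : 'M[k]_(V v, V w)) a b :
  ~~ (alive a v && alive b w) -> (pr v *m A *m io' w) a b = 0.
Proof.
have -> : pr v *m A *m io' w = alive_mx v *m (pr v *m A *m io' w) *m alive_mx w.
  have prP : alive_mx v *m pr v = pr v by rewrite -prK -mulmxA ioK mulmx1.
  have ioP : io' w *m alive_mx w = io' w by rewrite -prK' mulmxA ioK' mul1mx.
  by rewrite !mulmxA prP -[RHS]mulmxA ioP.
by rewrite mul_aliveE alive_mulE; case: alive; case: alive.
Qed.

Lemma sandwich_eqP v w (M M' : 'M[k]_n) :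
  io v *m M *m pr' w = io v *m M' *m pr' w <->
  (forall a b, alive a v -> alive b w -> M a b = M' a b).
Proof.
have E (A : 'M[k]_n) a b : alive a v -> alive b w ->
    A a b = (pr v *m (io v *m A *m pr' w) *m io' w) a b.
  rewrite !mulmxA prK -[_ *m pr' w *m io' w]mulmxA prK' mul_aliveE alive_mulE.
  by move=> -> ->.
split=> [eqM a b av bw | eqM]; first by rewrite (E M) // (E M') // eqM.
rewrite -[LHS]sandwichK -[RHS]sandwichK; congr (_ *m _ *m _); apply/matrixP=> a b.
have [/andP[av bw]|nab] := boolP (alive a v && alive b w).
  by rewrite -!E // eqM.
by rewrite !sandwich_alive.
Qed.

(** These maps are the homomorphisms from the first representation to the
    Auslander-Reiten translate of the second. *)
Lemma lowering_mapP (be : bwd_maps k V) :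
  (forall v, be v *m T' v = T v.+1 *m be v.+1) <->
  exists2 Z, supported seg_lt Z & forall v, be v = io v.+1 *m Z *m pr' v.
Proof.
split=> [rel|[Z supZ beE] v]; last first.
  have -> : be v *m T' v = io v.+1 *m (Z *m alive_mx v) *m pr' v.+1.
    by rewrite beE TE' -prK' !mulmxA.
  have -> : T v.+1 *m be v.+1 = io v.+1 *m (alive_mx v.+2 *m Z) *m pr' v.+1.
    by rewrite beE TE -prK !mulmxA.
  apply/sandwich_eqP => a b av bv; rewrite mul_aliveE alive_mulE.
  have [/andP[lt1 lt2]|nlt] := boolP (seg_lt a b); last by rewrite supZ // !if_same.
  by move: av bv; rewrite /alive => av bv; rewrite !ifT //; lia.
pose u v := pr v.+1 *m be v *m io' v.
have chain a b := @lowering_chain a b (fun v => u v a b).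
have {}chain a b : (~~ seg_lt a b -> forall v, u v a b = 0) /\
    (forall v, alive a v.+1 -> alive b v -> u v a b = u c a b).
  apply: chain => v; first exact: sandwich_alive.
  rewrite -mul_aliveE -alive_mulE.
  have -> : u v *m alive_mx v.+1 = pr v.+1 *m (be v *m T' v) *m io' v.+1.
    by rewrite /u TE' -prK' !mulmxA.
  have -> // : alive_mx v.+1 *m u v.+1 = pr v.+1 *m (be v *m T' v) *m io' v.+1.
  by rewrite rel /u TE -prK !mulmxA.
exists (u c) => [a b nlt|v]; first by have [/(_ nlt)] := chain a b.
rewrite -[LHS]sandwichK; apply/sandwich_eqP => a b av bv.
by have [_ /(_ v av bv)] := chain a b.
Qed.

Lemma hom_mapP (h : graded_map k V V) :
  (forall v, T v *m h v.+1 = h v *m T' v) <->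
  exists2 H, supported seg_le H & forall v, h v = io v *m H *m pr' v.
Proof.
split=> [rel|[H supH hE] v]; last first.
  have -> : T v *m h v.+1 = io v *m (alive_mx v.+1 *m H) *m pr' v.+1.
    by rewrite hE TE -prK !mulmxA.
  have -> : h v *m T' v = io v *m (H *m alive_mx v) *m pr' v.+1.
    by rewrite hE TE' -prK' !mulmxA.
  apply/sandwich_eqP => a b av bv; rewrite mul_aliveE alive_mulE.
  have [/andP[lt1 lt2]|nlt] := boolP (seg_le a b); last by rewrite supH // !if_same.
  by move: av bv; rewrite /alive => av bv; rewrite !ifT //; lia.
pose u v := pr v *m h v *m io' v.
have chain a b := @hom_chain a b (fun v => u v a b).
have {}chain a b : (~~ seg_le a b -> forall v, u v a b = 0) /\
    (forall v, alive a v -> alive b v -> u v a b = u c a b).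
  apply: chain => v; first exact: sandwich_alive.
  rewrite -mul_aliveE -alive_mulE.
  have -> : u v *m alive_mx v.+1 = pr v *m (h v *m T' v) *m io' v.+1.
    by rewrite /u TE' -prK' !mulmxA.
  have -> // : alive_mx v *m u v.+1 = pr v *m (h v *m T' v) *m io' v.+1.
  by rewrite -rel /u TE -prK !mulmxA.
exists (u c) => [a b nle|v]; first by have [/(_ nle)] := chain a b.
rewrite -[LHS]sandwichK; apply/sandwich_eqP => a b av bv.
by have [_ /(_ v av bv)] := chain a b.
Qed.

Lemma supported_neq0 r (M : 'M[k]_n) a b : supported r M -> M a b != 0 -> r a b.
Proof. by move=> rM; apply: contraNT => /rM ->. Qed.

Lemma lowering_hom_mul X H v : supported seg_lt X -> supported seg_le H ->
  io v.+1 *m X *m pr v *m (io v *m H *m pr' v) = io v.+1 *m (X *m H) *m pr' v.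
Proof.
move=> supX supH.
transitivity (io v.+1 *m (X *m (alive_mx v *m H)) *m pr' v).
  by rewrite -prK !mulmxA.
apply/sandwich_eqP => a b av bv; rewrite !mxE; apply: eq_bigr => j _;
  rewrite alive_mulE.
case: ifP => // /negbT jv; have [->|Xj] := eqVneq (X a j) 0;
  first by rewrite !mul0r.
have [->//|Hj] := eqVneq (H j b) 0.
have /andP[? ?] := supported_neq0 supX Xj;
  have /andP[? ?] := supported_neq0 supH Hj.
by move: av bv jv; rewrite /alive; lia.
Qed.

Lemma hom_lowering_mul H Y v : supported seg_le H -> supported seg_lt Y ->
  io v.+1 *m H *m pr' v.+1 *m (io' v.+1 *m Y *m pr' v) = io v.+1 *m (H *m Y) *m pr' v.
Proof.
move=> supH supY.
transitivity (io v.+1 *m (H *m (alive_mx v.+1 *m Y)) *m pr' v).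
  by rewrite -prK' !mulmxA.
apply/sandwich_eqP => a b av bv; rewrite !mxE; apply: eq_bigr => j _;
  rewrite alive_mulE.
case: ifP => // /negbT jv; have [->|Hj] := eqVneq (H a j) 0;
  first by rewrite !mul0r.
have [->//|Yj] := eqVneq (Y j b) 0.
have /andP[? ?] := supported_neq0 supH Hj;
  have /andP[? ?] := supported_neq0 supY Yj.
by move: av bv jv; rewrite /alive; lia.
Qed.

End TwoFrames.

Definition seg_onto (X Y : 'M[k]_n) : Prop := forall Z, supported seg_lt Z ->
  exists2 H, supported seg_le H & Z = X *m H - H *m Y.

Section LoweringCoboundary.

Variables (x y : datum k V).
Variables (io io' : forall v, 'M[k]_(V v, n)) (pr pr' : forall v, 'M[k]_(n, V v)).
Hypotheses (fr : frame x.1 io pr) (fr' : frame y.1 io' pr').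
Variables (X Y : 'M[k]_n).
Hypotheses (supX : supported seg_lt X) (supY : supported seg_lt Y).
Hypothesis xE : forall v, x.2 v = io v.+1 *m X *m pr v.
Hypothesis yE : forall v, y.2 v = io' v.+1 *m Y *m pr' v.

Lemma coboundary_frame H v : supported seg_le H ->
  (coboundary x y (fun v => io v *m H *m pr' v)).2 v =
  io v.+1 *m (X *m H - H *m Y) *m pr' v.
Proof.
move=> supH;
  rewrite /= xE yE (lowering_hom_mul fr fr') // (hom_lowering_mul fr fr') //.
by rewrite mulmxBr mulmxBl.
Qed.

End LoweringCoboundary.

Section Ext.

Variables (x y : datum k V).
Variables (io io' : forall v, 'M[k]_(V v, n)) (pr pr' : forall v, 'M[k]_(n, V v)).
Hypotheses (fr : frame x.1 io pr) (fr' : frame y.1 io' pr').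
Variables (X Y : 'M[k]_n).
Hypotheses (supX : supported seg_lt X) (supY : supported seg_lt Y).
Hypothesis xE : forall v, x.2 v = io v.+1 *m X *m pr v.
Hypothesis yE : forall v, y.2 v = io' v.+1 *m Y *m pr' v.

(** A strictly supported [Z] gives a cocycle without component along the arrows;
    a cochain bounding it is a homomorphism of representations of the quiver,
    that is, an element of the incidence algebra. *)
Lemma ext_exact_onto : ext_exact x y -> seg_onto X Y.
Proof.
move=> ex Z supZ.
pose be v := io v.+1 *m Z *m pr' v.
have rel v : be v *m y.1 v = x.1 v.+1 *m be v.+1.
  by apply/(lowering_mapP fr fr'): v; exists Z.
have [v|h hE] := ex (fun=> 0, be).
  by rewrite /cocycle_defect /= mulmx0 mul0mx addr0 subr0 rel subrr.
have [|H supH HE] := (hom_mapP fr fr' h).1.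
  by move=> v; apply/eqP; rewrite -subr_eq0; have [/= <-] := hE v.
exists H => //; apply/matrixP=> a b.
have [lt_ab|nlt] := boolP (seg_lt a b); last first.
  rewrite supZ // [RHS](_ : _ = 0) //.
  apply: (supportedB (r := seg_lt)) nlt.
    by apply: supportedM supX supH => i j l /andP[? ?] /andP[? ?]; rewrite /seg_lt;
      lia.
  by apply: supportedM supH supY => i j l /andP[? ?] /andP[? ?]; rewrite /seg_lt;
    lia.
have : be c = io c.+1 *m (X *m H - H *m Y) *m pr' c.
  rewrite -(coboundary_frame fr fr' supX supY) //;
    transitivity ((coboundary x y h).2 c).
    by have [] := hE c.
  by rewrite /= !HE.
move=> /(sandwich_eqP fr fr')/(_ a b); apply; move: lt_ab; rewrite /alive /seg_lt.
  by have := lo_le a; have := hi_ge b; lia.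
by have := lo_le b; have := hi_ge b; lia.
Qed.

Hypothesis hi_le : forall i, (hi i <= N)%N.

(** A cocycle [cc] pairs to zero with every coboundary of [(y, x)]; as the
    commutator map of [(Y, X)] is onto, it pairs to zero with all lowering maps.
    These are precisely the obstructions to bounding the component of [cc] along
    the arrows, which is then done by summing along the common vertices of two
    segments. The remaining component is a lowering map, bounded because the
    commutator map of [(X, Y)] is onto. *)
Lemma onto_ext_exact : Lambda x -> Lambda y ->
  seg_onto X Y -> (forall Z, supported seg_lt Z ->
    exists2 H, supported seg_le H & Z = Y *m H - H *m X) -> ext_exact x y.
Proof.
move=> Lx Ly ontoXY ontoYX cc cc0.
pose p v := pr v *m cc.1 v *m io' v.+1.
have p0 v a b : ~~ (alive a v && alive b v.+1) -> p v a b = 0.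
  exact: (sandwich_alive fr fr').
have psum a b : seg_lt b a -> \sum_(0 <= v < N.+1) p v a b = 0.
  move=> lt_ba; have [|H supH ZE] := ontoYX (delta_mx b a).
    by move=> i j; rewrite mxE; case: eqVneq => //= -> ; case: eqVneq => //= ->;
      rewrite lt_ba.
  rewrite big_mkord; pose g v := io' v *m H *m pr v.
  have g1 v : (coboundary y x g).1 v = 0.
    by apply/eqP; rewrite subr_eq0; apply/eqP; apply/(hom_mapP fr' fr): v; exists H.
  have := pairing_coboundary x y cc g; rewrite [RHS]big1 => [|v _]; last first.
    by rewrite cc0 mul0mx mxtrace0.
  rewrite /cochain_pairing => /(congr1 -%R); rewrite oppr0 -sumrN => pair0.
  rewrite -[RHS]pair0.
  apply: eq_bigr => v _; rewrite g1 mulmx0 mxtrace0 sub0r opprK.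
  rewrite (coboundary_frame fr' fr supY supX) // -ZE -mxtrace_delta /p.
  by rewrite !mulmxA [RHS]mxtrace_mulC !mulmxA [RHS]mxtrace_mulC !mulmxA.
have ccE v : cc.1 v = io v *m p v *m pr' v.+1 by rewrite (sandwichK fr fr').
clearbody p; pose s v : 'M[k]_n := \matrix_(a, b) if (lo a < lo b)%N
  then \sum_(0 <= w < v) p w a b else - \sum_(v <= w < N.+1) p w a b.
pose h v := io v *m s v *m pr' v.
have cc1 v : cc.1 v = (coboundary x y h).1 v.
  rewrite ccE.
  have -> : (coboundary x y h).1 v =
      io v *m (alive_mx v.+1 *m s v.+1 - s v *m alive_mx v) *m pr' v.+1.
    rewrite /= /h; have [[_ prK ->] [_ prK' ->]] := (fr v, fr' v).
    have [[_ prKS _] [_ prKS' _]] := (fr v.+1, fr' v.+1).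
    by rewrite mulmxBr mulmxBl -prKS -prK' !mulmxA.
  apply/(sandwich_eqP fr fr') => a b av bv.
  rewrite [RHS]mxE [X in _ + X]mxE alive_mulE mul_aliveE !mxE.
  have vN : (v < N.+1)%N by move: av; have := hi_le a; rewrite /alive; lia.
  have sum0 m m' : (m' < lo b)%N || (hi a < m)%N -> \sum_(m <= w < m') p w a b = 0.
    move=> mm'; rewrite big_nat_cond big1 // => w; rewrite andbT => ww.
    by apply: p0; rewrite /alive; lia.
  have [lt_ab|le_ba] := ltnP (lo a) (lo b).
    have -> : (if alive b v then \sum_(0 <= w < v) p w a b else 0) =
        \sum_(0 <= w < v) p w a b.
      by case: ifPn => // nbv; rewrite sum0 //; move: nbv bv; rewrite /alive; lia.
    rewrite -[LHS](addrK (\sum_(0 <= w < v) p w a b)); congr (_ - _).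
    have sumS : \sum_(0 <= w < v.+1) p w a b = \sum_(0 <= w < v) p w a b + p v a b.
      by rewrite big_nat_recr.
    rewrite addrC -sumS.
    case: ifPn => // nav.
    have := psum a b; rewrite (@big_cat_nat _ _ _ v.+1) //= [X in _ + X]sum0 ?addr0.
      by apply; rewrite /seg_lt; move: av bv nav; rewrite /alive; lia.
    by move: av nav; rewrite /alive; lia.
  have -> : alive b v by move: av bv; rewrite /alive; lia.
  rewrite opprK [X in _ + X]big_ltn // addrCA; case: ifPn => [_|nav];
    first by rewrite addNr addr0.
  by rewrite sum0 ?addr0 ?add0r //; move: av nav; rewrite /alive; lia.
pose cc' : datum k V := (fun=> 0, fun v => cc.2 v - (coboundary x y h).2 v).
have rel v : cc'.2 v *m y.1 v = x.1 v.+1 *m cc'.2 v.+1.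
  have E := cc0 v; have E' := cocycle_coboundary h v Lx Ly.
  rewrite /= [RHS]mulmxBr [LHS]mulmxBl; move: E E';
    rewrite /cocycle_defect -!cc1 /=.
  move: (cc.2 v *m y.1 v) (_ *m y.1 v) => A A';
    move: (x.2 v *m cc.1 v) (cc.1 v.+1 *m _) => B C.
  move: (x.1 v.+1 *m cc.2 v.+1) (x.1 v.+1 *m _) => D D'.
  move=> /eqP; rewrite subr_eq0 => /eqP <- /eqP; rewrite subr_eq0 => /eqP <-.
  by apply/matrixP=> i j; rewrite !mxE; ring.
have /(lowering_mapP fr fr')[Z supZ ZE] := rel.
have [H supH HE] := ontoXY Z supZ.
pose h' v := h v + io v *m H *m pr' v.
have [g1 g2] : (forall v, (coboundary x y (fun v => io v *m H *m pr' v)).1 v = 0) /\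
    forall v, (coboundary x y (fun v => io v *m H *m pr' v)).2 v = cc'.2 v.
  split=> v; last by rewrite (coboundary_frame fr fr' supX supY) // -HE -ZE.
  by apply/eqP; rewrite subr_eq0; apply/eqP; apply/(hom_mapP fr fr'): v; exists H.
exists h' => v;
  rewrite cc1 -[cc.2 v](subrK ((coboundary x y h).2 v)) -[_ - _]/(cc'.2 v) -g2.
split; last first.
  rewrite /= /h' mulmxDr mulmxDl opprD addrACA.
  by congr (_ + _); apply: addrC.
by rewrite -[LHS]addr0 -(g1 v) /= /h' mulmxDr mulmxDl opprD addrACA.
Qed.

End Ext.

End Frames.

End Segments.

(** * The representation of a permutation *)

Section SegmentSums.

Variables (k : fieldType) (N n : nat) (lo hi : 'I_n -> nat).
Hypothesis segP : forall i, is_segment N (lo i) (hi i).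

Lemma dsum_frame (r : seq 'I_n) : uniq r ->
  let M := \big[@dsum_rep k N / zero_rep k N]_(i <- r) seg_rep k (segP i) in
  exists (io : forall v, 'M[k]_(qspace M v, n)) (pr : forall v, 'M[k]_(n, qspace M v)),
    forall v, [/\ io v *m pr v = 1%:M,
      pr v *m io v = \matrix_(a, b) [&& a == b, a \in r & alive lo hi a v]%:R
      & qmap M v = io v *m pr v.+1].
Proof.
elim: r => [_|i r IHr /= /andP[ir /IHr{IHr}]].
  rewrite big_nil /=; exists (fun=> 0), (fun=> 0) => v; split.
  - by apply/matrixP=> -[].
  - by rewrite mulmx0; apply/matrixP=> a b; rewrite !mxE andbF.
  - by apply/matrixP=> -[].
rewrite big_cons; move: (\big[_/_]_(j <- r) _) => M [io [pr fr]].
pose io1 v : 'M[k]_(seg_space (segP i) v, n) := \matrix_(_, a) (a == i)%:R.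
pose pr1 v : 'M[k]_(n, seg_space (segP i) v) := \matrix_(a, _) (a == i)%:R.
have ipr0 v w : io1 v *m pr w = 0.
  have [ioK prK _] := fr w.
  rewrite -[pr w]mulmx1 -ioK (mulmxA (pr w)) prK mulmxA.
  rewrite [X in X *m _](_ : _ = 0) ?mul0mx //; apply/matrixP=> a b.
  rewrite !mxE big1 // => j _; rewrite !mxE; case: eqVneq => [->|];
    rewrite ?mul0r //.
  by rewrite (negPf ir) andbF mulr0.
have iopr0 v w : io v *m pr1 w = 0.
  have [ioK prK _] := fr v.
  rewrite -[io v]mul1mx -ioK -(mulmxA (io v)) prK -mulmxA.
  rewrite [X in _ *m X](_ : _ = 0) ?mulmx0 //; apply/matrixP=> a b.
  rewrite !mxE big1 // => j _; rewrite !mxE; case: (eqVneq j i) => [->|];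
    rewrite ?mulr0 //.
  by case: eqVneq => [->|]; rewrite ?(negPf ir) mul0r.
have io1E v w : io1 v *m pr1 w = const_mx 1.
  apply/matrixP=> a b; rewrite !mxE (bigD1 i) //= big1 => [|j /negPf ji].
    by rewrite !mxE eqxx mulr1 addr0.
  by rewrite !mxE ji mul0r.
exists (fun v => col_mx (io1 v) (io v)), (fun v => row_mx (pr1 v) (pr v)) => v.
have [ioK prK qE] := fr v; split.
- rewrite mul_col_row ipr0 iopr0 ioK io1E [RHS]scalar_mx_block; congr block_mx.
  apply/matrixP=> a b; rewrite !mxE /=; move: a b; rewrite /=.
  by case: (_ <= _ <= _)%N => -[[|?] // ?] [[|?] // ?].
- rewrite mul_row_col prK; apply/matrixP=> a b; rewrite [LHS]mxE.
  have -> : (pr1 v *m io1 v) a b = [&& a == b, a == i & alive lo hi a v]%:R.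
    rewrite mxE (eq_bigr (fun=> ((a == i) && (b == i))%:R)) => [|j _]; last first.
      by rewrite !mxE -natrM mulnb.
    rewrite sumr_const card_ord /alive /= -mulrnA mulnb; congr _%:R.
    by case: (eqVneq a i) => [->|]; rewrite ?andbF // [i == b]eq_sym.
  rewrite !mxE inE -natrD; congr _%:R; case: eqVneq => //= _;
    case: eqVneq => //= ->.
  by rewrite (negPf ir) addn0.
- by rewrite /= mul_col_row ipr0 iopr0 -qE io1E.
Qed.

End SegmentSums.

Lemma frame_iso (k : fieldType) n (lo hi : 'I_n -> nat) N (V : grspace N)
    (T T' : fwd_maps k V) io pr :
  qrep_iso T T' -> frame lo hi T' io pr ->
  exists io' pr', frame lo hi T io' pr'.
Proof.
move=> [f [g [hom_f hom_g fg]]] fr.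
exists (fun v => f v *m io v), (fun v => pr v *m g v) => v.
have [fgv gfv] := fg v; have [ioK prK TE] := fr v; split.
- by rewrite -mulmxA (mulmxA (io v)) ioK mul1mx.
- by rewrite -mulmxA (mulmxA (g v)) gfv mul1mx.
have [fgS _] := fg v.+1.
by rewrite -[T v]mulmx1 -fgS mulmxA hom_f TE !mulmxA.
Qed.

(** * General points of a component *)

Section Polynomials.

Variables (k : fieldType) (N : nat) (V : grspace N).

Definition polynomial_on_data (F : datum k V -> k) : Prop :=
  exists (m : nat) (P : {mpoly k[m]}) (c : 'I_m -> Defs.coord V),
    forall x, F x = P.@[fun i => coord_val x (c i)].

Lemma polynomial_on_data_ring : function_ring polynomial_on_data.
Proof.
have merge m1 m2 (P : {mpoly k[m1]}) (Q : {mpoly k[m2]}) c d :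
    exists (P' Q' : {mpoly k[m1 + m2]}) (e : 'I_(m1 + m2) -> Defs.coord V),
    forall x : datum k V,
      P'.@[fun i => coord_val x (e i)] = P.@[fun i => coord_val x (c i)] /\
      Q'.@[fun i => coord_val x (e i)] = Q.@[fun i => coord_val x (d i)].
  exists (P \mPo [tuple 'X_(lshift m2 i) | i < m1]),
    (Q \mPo [tuple 'X_(rshift m1 i) | i < m2]),
    (fun i => match split i with inl j => c j | inr j => d j end) => x.
  rewrite !comp_mpoly_meval; split; apply: meval_eq => i.
    by rewrite tnth_mktuple mevalXU (unsplitK (inl i)).
  by rewrite tnth_mktuple mevalXU (unsplitK (inr i)).
split.
- by move=> F G FG [m [P [c HP]]]; exists m, P, c => x; rewrite -FG.
- by move=> a;
  exists 0%N, a%:MP, (fun i : 'I_0 => False_rect _ (notF (ltn_ord i))) => x;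
  rewrite mevalC.
- move=> F G [m1 [P [c HP]]] [m2 [Q [d HQ]]].
  have [P' [Q' [e He]]] := merge _ _ P Q c d.
  exists (m1 + m2)%N, (P' + Q'), e => x.
  by have [EP EQ] := He x; rewrite mevalD EP EQ HP HQ.
move=> F G [m1 [P [c HP]]] [m2 [Q [d HQ]]].
have [P' [Q' [e He]]] := merge _ _ P Q c d.
exists (m1 + m2)%N, (P' * Q'), e => x.
by have [EP EQ] := He x; rewrite mevalM EP EQ HP HQ.
Qed.

Lemma regular_coord1 v : regular_mx polynomial_on_data (fun x : datum k V => x.1 v).
Proof.
by move=> i j; exists 1%N, 'X_ord0, (fun=> TCoord i j) => x; rewrite mevalXU.
Qed.

Lemma regular_coord2 v : regular_mx polynomial_on_data (fun x : datum k V => x.2 v).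
Proof.
by move=> i j; exists 1%N, 'X_ord0, (fun=> BCoord i j) => x; rewrite mevalXU.
Qed.

Lemma closure_nonzero (S : datum k V -> Prop) x F :
  zariski_closure S x -> polynomial_on_data F -> F x != 0 ->
  exists2 y, S y & F y != 0.
Proof.
move=> clx [m [P [c HP]]] Fx; apply: NNPP => none; case/eqP: Fx.
rewrite HP; apply: clx => y Sy; rewrite -HP; apply/eqP.
by have [//|Fy] := boolP (F y == 0); case: none; exists y.
Qed.

(** Exactness in both orders can be moved from points of the closure of [S] to
    points of [S]; for a pair of points, one is moved while the other stays. *)
Lemma ext_exact_general (diag : bool) (S : datum k V -> Prop) (x y : datum k V) :
  (forall z, S z -> Lambda z) -> Lambda x -> Lambda y ->
  zariski_closure S x -> zariski_closure S y -> (diag -> x = y) -> ext_exact x y ->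
  exists x' y', [/\ S x', S y', diag -> x' = y', ext_exact x' y' & ext_exact y' x'].
Proof.
move=> SL Lx Ly clx cly xy exact_xy; have exact_yx := ext_exact_sym exact_xy.
have PR := polynomial_on_data_ring.
have R1 := regular_coord1; have R2 := regular_coord2.
case: diag xy => [/(_ isT) xy|_].
  rewrite -{y Ly cly}xy in exact_xy exact_yx *.
  have [||||F [PF F0 HF]] := ext_exact_open (xf := id) (yf := id) PR _ _ _ _ exact_xy => //.
  have [z Sz Fz] := closure_nonzero clx PF F0.
  by exists z, z; split=> //; apply: HF => //; apply: SL.
have move1 u w : ext_exact u w -> ext_exact w u -> zariski_closure S u -> Lambda w ->
    exists z, [/\ S z, ext_exact z w & ext_exact w z].
  move=> uw wu clu Lw.
  have [|||||F [PF F0 HF]] := ext_exact_open (xf := id) (yf := fun=> w) (w0 := u) PR => //;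
    try by move=> v; apply: regular_const.
  have [|||||G [PG G0 HG]] := ext_exact_open (xf := fun=> w) (yf := id) (w0 := u) PR => //;
    try by move=> v; apply: regular_const.
  have [||z Sz] := closure_nonzero (F := fun z => F z * G z) clu.
  - exact: (fring_mul PR).
  - by rewrite mulf_neq0.
  rewrite mulf_eq0 negb_or => /andP[Fz Gz].
  by exists z; split=> //; [apply: HF | apply: HG] => //; apply: SL.
have [x' [Sx' ex1 ex2]] := move1 x y exact_xy exact_yx clx Ly.
have [y' [Sy' ex3 ex4]] := move1 y x' ex2 ex1 cly (SL _ Sx').
by exists x', y'.
Qed.

End Polynomials.

(** * Permutations and their patterns *)

Definition perm_lt n (sigma : 'S_n) (a b : 'I_n) : bool :=
  (b < a)%N && (sigma a < sigma b)%N.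

Section Permutation.

Variables (k : closedFieldType) (n : nat) (sigma : 'S_n).

Let lo (i : 'I_n) : nat := i.+1.
Let hi (i : 'I_n) : nat := (2 * n - (sigma i).+1)%N.

Let lo_gt0 i : (0 < lo i)%N. Proof. by []. Qed.
Let lo_le i : (lo i <= n)%N. Proof. exact: ltn_ord. Qed.
Let hi_ge i : (n <= hi i)%N.
Proof. by rewrite /hi; have := ltn_ord (sigma i); lia. Qed.
Let hi_le i : (hi i <= 2 * n - 1)%N. Proof. by rewrite /hi; lia. Qed.

Lemma perm_ltE a b : seg_lt lo hi a b = lt_on (perm_lt sigma) setT a b.
Proof.
rewrite /seg_lt /lt_on /perm_lt !inE /= /lo /hi ltnS; congr (_ && _).
by have := ltn_ord (sigma a); have := ltn_ord (sigma b); lia.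
Qed.

Lemma perm_leE a b : seg_le lo hi a b = le_on (perm_lt sigma) setT a b.
Proof.
rewrite /seg_le /le_on /perm_lt !inE /= /lo /hi ltnS.
case: eqVneq => [->|ab]; first by rewrite !leqnn.
have {}ab : nat_of_ord a <> b by apply/eqP; rewrite (inj_eq val_inj).
have : nat_of_ord (sigma a) <> sigma b.
  by move=> /val_inj/perm_inj/(congr1 val).
by have := ltn_ord (sigma a); have := ltn_ord (sigma b); lia.
Qed.

Lemma seg_ontoE (X Y : 'M[k]_n) :
  seg_onto lo hi X Y <-> commutator_onto (perm_lt sigma) setT X Y.
Proof.
have ltW Z : supported (seg_lt lo hi) Z <-> supported (lt_on (perm_lt sigma) setT) Z.
  by split; apply: supportedW => a b; rewrite perm_ltE.
have leW Z : supported (seg_le lo hi) Z <-> supported (le_on (perm_lt sigma) setT) Z.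
  by split; apply: supportedW => a b; rewrite perm_leE.
by split=> onto Z /ltW/onto[H /leW supH ZE]; exists H.
Qed.

Lemma M_perm_frame : exists io pr, frame lo hi (qmap (M_perm k sigma)) io pr.
Proof.
have [io [pr fr]] := dsum_frame k (perm_segment sigma) (index_enum_uniq 'I_n).
exists io, pr => v; have [ioK prK qE] := fr v; split=> //.
by rewrite prK; apply/matrixP=> a b; rewrite !mxE mem_index_enum.
Qed.

Definition vanishing_pair (diag : bool) : Prop :=
  exists x y : datum k (V_perm k sigma),
    [/\ C_perm x, C_perm y, diag -> x = y & Ext1_zero x y].

Lemma vanishing_pair_onto diag :
  vanishing_pair diag -> onto_pair k (perm_lt sigma) diag setT.
Proof.
move=> [x [y [[Lx clx] [Ly cly] xy /(Ext1_zero_exact Lx Ly) ex]]].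
have [z []//|x' [y' [[Lx' isox] [Ly' isoy] xy' ex1 ex2]]] :=
  ext_exact_general _ Lx Ly clx cly xy ex.
have [io [pr frM]] := M_perm_frame.
have [io1 [pr1 fr1]] := frame_iso isox frM.
have [X supX xE] := (lowering_mapP lo_gt0 lo_le hi_ge fr1 fr1 x'.2).1 ((LambdaP x').1 Lx').
case: diag xy xy' => xy xy'; last first.
  have [io2 [pr2 fr2]] := frame_iso isoy frM.
  have [Y supY yE] := (lowering_mapP lo_gt0 lo_le hi_ge fr2 fr2 y'.2).1 ((LambdaP y').1 Ly').
  exists X, Y; split=> //.
  - by apply: supportedW supX => a b; rewrite perm_ltE.
  - by apply: supportedW supY => a b; rewrite perm_ltE.
  - by apply/seg_ontoE;
    apply: (ext_exact_onto lo_gt0 lo_le hi_ge fr1 fr2 supX supY xE yE).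
  - by apply/seg_ontoE;
    apply: (ext_exact_onto lo_gt0 lo_le hi_ge fr2 fr1 supY supX yE xE).
have onto : commutator_onto (perm_lt sigma) setT X X.
  rewrite -(xy' isT) in ex1.
  by apply/seg_ontoE;
    apply: (ext_exact_onto lo_gt0 lo_le hi_ge fr1 fr1 supX supX xE xE).
by exists X, X; split=> //; apply: supportedW supX => a b; rewrite perm_ltE.
Qed.

Lemma onto_vanishing_pair diag :
  onto_pair k (perm_lt sigma) diag setT -> vanishing_pair diag.
Proof.
move=> [X [Y [XY supX supY ontoXY ontoYX]]].
have [io [pr fr]] := M_perm_frame.
pose z (X : 'M[k]_n) : datum k (V_perm k sigma) :=
  (qmap (M_perm k sigma), fun v => io v.+1 *m X *m pr v).
have sup Z : supported (lt_on (perm_lt sigma) setT) Z -> supported (seg_lt lo hi) Z.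
  by apply: supportedW => a b; rewrite perm_ltE.
have Lz Z : supported (lt_on (perm_lt sigma) setT) Z -> Lambda (z Z).
  move=> /sup supZ; apply/LambdaP.
  by apply/(lowering_mapP lo_gt0 lo_le hi_ge fr fr); exists Z.
have iso1 : qrep_iso (qmap (M_perm k sigma)) (qmap (M_perm k sigma)).
  exists (fun=> 1%:M), (fun=> 1%:M); split=> v; rewrite ?mulmx1 ?mul1mx //.
have Cz Z : supported (lt_on (perm_lt sigma) setT) Z -> C_perm (z Z).
  by move=> supZ; split; [apply: Lz | move=> m P c; apply; split=> //; apply: Lz].
exists (z X), (z Y); split; [exact: Cz | exact: Cz | by move=> /XY -> |].
apply: exact_Ext1_zero; [exact: Lz | exact: Lz |].
apply: (@onto_ext_exact _ _ _ _ _ lo_gt0 lo_le hi_ge _ _ (z X) (z Y) _ _ _ _ fr fr X Y) => //.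
- exact: sup.
- exact: sup.
- exact: Lz.
- exact: Lz.
- exact/seg_ontoE.
- exact/seg_ontoE.
Qed.

End Permutation.

(** The incidence matrix [F] of [f] identifies the incidence algebra of [tau]
    with that of the image of [f]. *)
Lemma onto_pair_pattern (k : closedFieldType) m n (tau : 'S_m) (sigma : 'S_n)
    (f : 'I_m -> 'I_n) diag :
  injective f -> (forall i j, perm_lt tau i j = perm_lt sigma (f i) (f j)) ->
  onto_pair k (perm_lt sigma) diag [set f i | i : 'I_m] ->
  onto_pair k (perm_lt tau) diag setT.
Proof.
move=> f_inj f_lt [X [Y [XY supX supY ontoXY ontoYX]]].
set I := [set _ | _ in _] in supX supY ontoXY ontoYX.
pose F : 'M[k]_(m, n) := \matrix_(i, a) (f i == a)%:R.
have supF : supported (fun i a => f i == a) F.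
  by move=> i a /negPf; rewrite mxE => ->.
have supFt : supported (fun a i => f i == a) F^T.
  by move=> a i /negPf; rewrite !mxE => ->.
have FE (M : 'M[k]_n) i j : (F *m M *m F^T) i j = M (f i) (f j).
  rewrite mxE (bigD1 (f j)) //= big1 => [|b /negPf bj]; rewrite !mxE.
    rewrite eqxx mulr1 addr0 (bigD1 (f i)) //= big1 => [|a /negPf ai]; rewrite !mxE.
      by rewrite eqxx mul1r addr0.
    by rewrite eq_sym ai mul0r.
  by rewrite eq_sym bj mulr0.
have FFt : F *m F^T = 1%:M.
  apply/matrixP=> i j; rewrite -{1}[F]mulmx1 FE !mxE.
  by rewrite (inj_eq f_inj).
have idI (M : 'M[k]_n) : supported (lt_on (perm_lt sigma) I) M ->
    M *m (F^T *m F) = M /\ F^T *m F *m M = M.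
  move=> supM; have FtF : F^T *m F = \matrix_(a, b) ((a == b) && (a \in I))%:R.
    apply/matrixP=> a b; rewrite !mxE; have [/imsetP[i _ ->]|aI] := boolP (a \in I).
      rewrite andbT (bigD1 i) //= big1 => [|j ji];
        rewrite !mxE ?eqxx ?mul1r ?addr0 //.
      by rewrite (inj_eq f_inj) (negPf ji) mul0r.
    rewrite andbF big1 // => i _; rewrite !mxE; case: eqVneq => [fia|];
      last by rewrite mul0r.
    by rewrite -fia imset_f in aI.
  rewrite FtF; split; apply/matrixP=> a b; rewrite mxE.
    rewrite (bigD1 b) //= big1 => [|j /negPf jb]; rewrite !mxE ?eqxx ?addr0 /=.
      by have [bI|/negPf bI] := boolP (b \in I);
        rewrite ?mulr1 // supM ?mul0r // /lt_on bI andbF.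
    by rewrite jb mulr0.
  rewrite (bigD1 a) //= big1 => [|j /negPf ja]; rewrite !mxE ?eqxx ?addr0 /=.
    by have [aI|/negPf aI] := boolP (a \in I);
      rewrite ?mul1r // supM ?mulr0 // /lt_on aI.
  by rewrite eq_sym ja mul0r.
have down M : supported (lt_on (perm_lt sigma) I) M ->
    supported (lt_on (perm_lt tau) setT) (F *m M *m F^T).
  move=> supM i j; rewrite /lt_on !inE f_lt /= => nij; rewrite FE supM //.
  by apply: contra nij => /and3P[].
have onto M M' : supported (lt_on (perm_lt sigma) I) M ->
    supported (lt_on (perm_lt sigma) I) M' ->
    commutator_onto (perm_lt sigma) I M M' ->
    commutator_onto (perm_lt tau) setT (F *m M *m F^T) (F *m M' *m F^T).
  move=> supM supM' ontoM Z supZ.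
  have [|H supH ZE] := ontoM (F^T *m Z *m F).
    apply: (supportedM (r := fun a j => [exists i, (f i == a) && perm_lt tau i j])) supF.
      move=> a j b /existsP[i /andP[/eqP <- ij]] /eqP <-.
      by rewrite /lt_on !imset_f //= -f_lt.
    apply: supportedM supFt supZ => a i j /eqP fia /and3P[_ _ ij].
    by apply/existsP; exists i; rewrite fia eqxx.
  exists (F *m H *m F^T).
    move=> i j nij; rewrite FE supH //; apply: contra nij => /and3P[_ _].
    by rewrite /le_on !inE (inj_eq f_inj) f_lt.
  have [M1 _] := idI M supM; have [_ M2] := idI M' supM'.
  transitivity (F *m (F^T *m Z *m F) *m F^T).
    by rewrite !mulmxA FFt mul1mx -mulmxA FFt mulmx1.
  rewrite ZE mulmxBr mulmxBl; congr (_ - _).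
    by rewrite -{1}M1 !mulmxA.
  by rewrite -{1}M2 !mulmxA.
exists (F *m X *m F^T), (F *m Y *m F^T); split.
- by move=> /XY ->.
- exact: down.
- exact: down.
- exact: onto.
- exact: onto.
Qed.

Theorem theorem5p5 (k : closedFieldType) (m n : nat)
    (tau : 'S_m) (sigma : 'S_n) :
  pattern_in tau sigma ->
  (rigid k sigma -> rigid k tau) /\ (pseudorigid k sigma -> pseudorigid k tau).
Proof.
move=> [f [f_mono f_pat]].
have f_lt i j : (f i < f j)%N = (i < j)%N.
  apply/idP/idP => [lt_f|]; last exact: f_mono.
  rewrite ltnNge; apply/negP; rewrite leq_eqVlt => /orP[/eqP/val_inj ij|/f_mono].
    by rewrite ij ltnn in lt_f.
  by rewrite ltnNge ltnW.
have f_inj : injective f.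
  move=> i j eq_f; apply/val_inj.
  by have := f_lt i j; have := f_lt j i; rewrite eq_f ltnn; case: ltngtP.
have down diag : vanishing_pair k sigma diag -> vanishing_pair k tau diag.
  move=> /vanishing_pair_onto onto; apply: onto_vanishing_pair.
  apply: (onto_pair_pattern (sigma := sigma) f_inj) => [i j|].
    by rewrite /perm_lt f_lt f_pat.
  apply: onto_pair_subset onto.
    by move=> b a c /andP[ab ba'] /andP[bc cb']; apply/andP; split; lia.
  by move=> a b /andP[].
split=> [[x [Cx ext_x]] | [x [y [Cx Cy ext_xy]]]].
  have [|x' [y' [Cx' Cy' xy' ext']]] := down true; first by exists x, x.
  by exists x'; split=> //; rewrite {2}(xy' isT).
have [|x' [y' [Cx' Cy' _ ext']]] := down false; first by exists x, y.
by exists x', y'.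
Qed.
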